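(* Let $\alpha>0$. Let $N_1,N_2,N_3\in 2^{\mathbb{N}}$ be dyadic numbers with $$N_3\le N_1\exp\Big(\frac{-\log N_1}{\log\log N_1}\Big),$$ and let $f_1,f_2,f_3\in L^2(\mathbb{T})$ satisfy $\operatorname{supp}(\hat f_i)\subseteq[N_i/2,N_i]$ for $i=1,2,3$. Then $$\int_{[0,N_1^{-\alpha}]\times\mathbb{T}}|e^{it\Delta}f_1|^2\,|e^{it\Delta}f_2|^2\,|e^{it\Delta}f_3|^2\,dx\,dt\ \lesssim_\alpha\ \prod_{i=1}^3\|f_i\|_{L^2(\mathbb{T})}^2,$$ where the implicit constant depends only on $\alpha$.
   Context: $\mathbb{T}=\mathbb{R}/(2\pi\mathbb{Z})$ and $\hat f(k)=\int_{\mathbb{T}}e^{-ixk}f(x)\,dx$ for $k\in\mathbb{Z}$. The Schrödinger propagator is $e^{it\Delta}f(x)=\frac1{2\pi}\sum_{k\in\mathbb{Z}}e^{i(kx-tk^2)}\hat f(k)$. *)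

(* Defs.v *)
From HB Require Import structures.
From mathcomp Require Import all_boot all_order all_algebra.
From mathcomp Require Import all_classical all_reals all_analysis.
From mathcomp Require Import complex.
Set Implicit Arguments.
Unset Strict Implicit.
Unset Printing Implicit Defensive.
Import Order.TTheory GRing.Theory Num.Theory.
Import numFieldNormedType.Exports.
Local Open Scope classical_set_scope.
Local Open Scope ring_scope.

Definition dyadic (N : nat) : Prop := exists n : nat, N = (2 ^ n)%N.

(* Functions on T = R / 2 pi Z are 2 pi-periodic functions on R; integrals over
   T are integrals over this fundamental domain. *)
Definition circle (R : realType) : set R := `[0, 2 * pi[.
Arguments circle R : clear implicits.

Definition cis (R : realType) (t : R) : R[i] := (cos t +i* sin t)%C.

Definition cintegral (R : realType) (D : set R) (f : R -> R[i]) : R[i] :=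
  ((\int[lebesgue_measure]_(x in D) complex.Re (f x))
   +i* (\int[lebesgue_measure]_(x in D) complex.Im (f x)))%C.

Definition L2norm (R : realType) (f : R -> R[i]) : \bar R :=
  ((\int[lebesgue_measure]_(x in circle R) (ComplexField.Normc.normc (f x) ^+ 2)%:E) `^ 2^-1)%E.

(* Measurability is Borel measurability: every class in L^2(T) has a Borel
   representative. *)
Definition L2_circle (R : realType) (f : R -> R[i]) : Prop :=
  [/\ periodic f (2 * pi),
      measurable_fun [set: R] (fun x => complex.Re (f x)),
      measurable_fun [set: R] (fun x => complex.Im (f x)) &
      (L2norm f < +oo)%E].

Definition fourier (R : realType) (f : R -> R[i]) (k : int) : R[i] :=
  cintegral (circle R) (fun x => cis (- (x * k%:~R)) * f x).

(* supp (fourier f) is contained in the real interval [a, b] *)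
Definition fourier_supp (R : realType) (f : R -> R[i]) (a b : R) : Prop :=
  forall k : int, fourier f k != 0 -> a <= k%:~R <= b.

(* The series over Z is the limit of its partial sums over |k| <= n; these are
   eventually constant when fourier f has bounded support. *)
Definition schrodinger (R : realType) (f : R -> R[i]) (t x : R) : R[i] :=
  ((2 * pi)^-1)%:C%C *
  limn (fun n : nat => \sum_(0 <= j < n.*2.+1)
          let k : int := j%:Z - n%:Z in
          cis (k%:~R * x - t * k%:~R ^+ 2) * fourier f k : R[i]^o).

(* Main.v *)
(* The product of the three waves is a trigonometric polynomial with frequencies
   (A, Q) = (k1 + k2 + k3, k1^2 + k2^2 + k3^2). On a time interval of length 1/H,
   with H about N1^alpha, its square is dominated by that of its product with a
   normalised Dirichlet kernel, so Parseval in x and t reduces the estimate to a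
   count: O(H) triples have a given A and Q in a window of length H.

   If N2 > 2 N1^2, then A and Q determine the triple. Otherwise put
   (x, y) = (A - 3 k3, k1 - k2); then x^2 + 3 y^2 = n := 6 Q - 2 A^2 <= X, a power
   of N1. As k3 <= N3, two such points with the same n (and y of the same sign)
   have |x y' - x' y| <= n / Delta, with Delta larger than every power of log N1.

   Write n = a b with a the part of n made of the primes <= y. The points on the
   conic fall into at most 4^Omega(b) classes modulo b, and two points of one class
   give a solution of c^2 + 3 d^2 = a^2 with |d| <= a / Delta. When a <= D, a small
   power of N1, solutions with d <> 0 are so rare on average over n that they beat
   the trivial weight 4^Omega(b); otherwise the class is a single point. Choosing y
   as large as possible given a <= D, the weight 4^Omega(b) is bounded unless the
   part of n made of small primes exceeds D, and by Rankin's method this happens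
   for so few n that the weighted sum is still O(H). *)

Require Import Defs.
From HB Require Import structures.
From mathcomp Require Import all_boot all_order all_algebra.
From mathcomp Require Import all_classical all_reals all_analysis.
From mathcomp Require Import complex measurable_realfun.
From mathcomp Require Import ring lra zify.
Import Order.TTheory GRing.Theory Num.Theory.
Import numFieldNormedType.Exports.
Local Open Scope classical_set_scope.
Local Open Scope ring_scope.

(** * Points on the conic x^2 + 3 y^2 = n *)

(** The divisor bound for a single n costs up to exp(c log N1 / log log N1), so the window of length
    H has to serve as an average over n, and every weight must be beaten by the rarity of the n that
    carry it.

    All scales are written as 2^(2^j): X = 2^(2^s), D = 2^(2^(s-g)) with g fixed by alpha,
    smoothness levels 2^(2^t'). Raising t' by one squares the level and halves the possible number
    of larger prime factors, so the weights fall doubly exponentially and the sum over levels is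
    geometric.

    The shape of the hypothesis on N3 comes from the lowest level. There 2^t lies between 80 s and
    160 s, so the level is a power of log X, and n <= X has at most 2^(s-t) larger prime factors.
    The trivial weight 4^(2^(s-t)) is then exp(O(log N1 / log log N1)), and Delta, about (N1 /
    N3)^(1/2), exceeds it with a factor 2^(4 s), a power of log X, to spare.

    The primes 2 and 3 do not split in Q(sqrt(-3)) and are always kept in the smooth part. *)

Definition norm3 (z : int * int) : int := z.1 ^+ 2 + 3 * z.2 ^+ 2.

(** The coefficient of sqrt(-3) in conj(z) w, where z stands for z.1 + z.2 sqrt(-3) and [norm3] is
    the norm. With r = z.1 w.1 + 3 z.2 w.2 the rational part, norm3 z * norm3 w = r^2 + 3 (det2 z
    w)^2. *)
Definition det2 (z w : int * int) : int := z.1 * w.2 - w.1 * z.2.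

Lemma pigeonhole_filter (T : eqType) (m : nat) (s : seq T) (f : T -> nat) :
  (forall x, x \in s -> (f x < m)%N) ->
  s != [::] -> exists i : nat, (size s <= m * size [seq x <- s | f x == i])%N.
Proof.
move=> fm s0.
have m_gt0 : (0 < m)%N.
  by case: s s0 fm => // x s _ fm; apply: leq_ltn_trans (fm x _); rewrite ?inE ?eqxx.
have szE : size s = (\sum_(i < m) size [seq x <- s | f x == i])%N.
  elim: s fm {s0} => [|x s IH] fm; first by rewrite big1.
  rewrite /= IH; last by move=> y ys; apply: fm; rewrite inE ys orbT.
  have fx := fm x (mem_head _ _).
  rewrite (bigD1 (Ordinal fx)) //= [in RHS](bigD1 (Ordinal fx)) //= eqxx /= addSn.
  congr (_ + _).+1; apply: eq_bigr => i /negP ni; case: eqP => // e.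
  by case: ni; apply/eqP/val_inj.
case: (boolP [exists i : 'I_m, (size s <= m * size [seq x <- s | f x == i])%N]).
  by case/existsP=> i Hi; exists i.
rewrite negb_exists => /forallP H; exfalso.
have : (\sum_(i < m) m * size [seq x <- s | f x == i] < \sum_(i < m) size s)%N.
  rewrite [in X in (_ < X)%N](bigD1 (Ordinal m_gt0)) //= (bigD1 (Ordinal m_gt0)) //=.
  rewrite -addSn leq_add //; first by have := H (Ordinal m_gt0); rewrite -ltnNge.
  by apply: leq_sum => i _; have := H i; rewrite -ltnNge => /ltnW.
by rewrite -big_distrr /= -szE sum_nat_const card_ord ltnn.
Qed.

Lemma prime_dvdzM (p : nat) (x y : int) : prime p ->
  (p %| x * y)%Z = (p %| x)%Z || (p %| y)%Z.
Proof. by move=> pp; rewrite !dvdzE abszM Euclid_dvdM. Qed.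

Lemma prime_dvdz_nat (p m : nat) : prime p -> (0 < m < p)%N -> (p %| m%:Z)%Z = false.
Proof.
move=> pp /andP[m0 mp]; rewrite dvdzE /=; apply/negP => /dvdn_leq; lia.
Qed.

Section PrimePower.
Variables (p k : nat) (n : int).
Hypotheses (pp : prime p) (p3 : (3 < p)%N) (k_gt0 : (0 < k)%N).
Hypothesis (pkn : ((p ^ k)%N %| n)%Z).

Let pn : (p %| n)%Z.
Proof. by apply: dvdz_trans pkn; rewrite dvdzE /= dvdn_exp. Qed.

Let primitive_coords (z : int * int) : norm3 z = n ->
  ~~ ((p %| z.1)%Z && (p %| z.2)%Z) -> ~~ (p %| z.1)%Z /\ ~~ (p %| z.2)%Z.
Proof.
move=> zn; rewrite negb_and.
have : (p %| z.1 ^+ 2 + 3 * z.2 ^+ 2)%Z by rewrite -/(norm3 z) zn.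
have [p1|p1] := boolP (p %| z.1)%Z; have [p2|p2] := boolP (p %| z.2)%Z => //.
- rewrite rpredDl; last by rewrite expr2 dvdz_mulr.
  rewrite expr2 !prime_dvdzM // (negPf p2) !orbF.
  by rewrite prime_dvdz_nat.
- rewrite rpredDr; last by rewrite expr2 mulrCA dvdz_mulr.
  by rewrite expr2 !prime_dvdzM // (negPf p1).
Qed.

Let coprime_ppow (x : int) : ~~ (p %| x)%Z -> coprimez (p ^ k)%N x.
Proof.
by move=> px; rewrite coprimezE /= coprimeXl // prime_coprime.
Qed.

(** The two determinants multiply to n (z.2^2 - w.2^2) and differ by 2 z.1 w.2, which is prime to p.
    So p divides only one of them, and that one absorbs all of p^k. *)
Lemma ppow_dvd_det_or_conj (z w : int * int) : norm3 z = n -> norm3 w = n ->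
  ~~ ((p %| z.1)%Z && (p %| z.2)%Z) -> ~~ ((p %| w.1)%Z && (p %| w.2)%Z) ->
  ((p ^ k)%N %| det2 z w)%Z || ((p ^ k)%N %| det2 z (w.1, - w.2))%Z.
Proof.
move=> zn wn /(primitive_coords _ zn)[z1 z2] /(primitive_coords _ wn)[w1 w2].
have uv : det2 z w * det2 z (w.1, - w.2) = n * (z.2 ^+ 2 - w.2 ^+ 2).
  have zE : z.1 ^+ 2 = n - 3 * z.2 ^+ 2 by rewrite -zn /norm3; ring.
  have wE : w.1 ^+ 2 = n - 3 * w.2 ^+ 2 by rewrite -wn /norm3; ring.
  transitivity (w.1 ^+ 2 * z.2 ^+ 2 - z.1 ^+ 2 * w.2 ^+ 2).
    by rewrite /det2 /=; ring.
  by rewrite zE wE; ring.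
have [pu|pu] := boolP (p %| det2 z w)%Z; last first.
  apply/orP; right; rewrite -(Gauss_dvdzr _ (coprime_ppow _ pu)) uv.
  by rewrite dvdz_mulr.
have [pv|/coprime_ppow pv] := boolP (p %| det2 z (w.1, - w.2))%Z; last first.
  by apply/orP; left; rewrite -(Gauss_dvdzl _ pv) uv dvdz_mulr.
have : (p %| det2 z w - det2 z (w.1, - w.2))%Z by rewrite rpredB.
have -> : det2 z w - det2 z (w.1, - w.2) = 2 * (z.1 * w.2) by rewrite /det2 /=; ring.
rewrite !prime_dvdzM // (negPf z1) (negPf w2) !orbF prime_dvdz_nat //=.
by lia.
Qed.

(** Divisibility of [det2 z u] says that u is proportional to z modulo p^k; this passes from z to
    the pair u, w because z.1 is a unit modulo p. *)
Lemma ppow_dvd_det_trans (z u w : int * int) : norm3 z = n ->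
  ~~ ((p %| z.1)%Z && (p %| z.2)%Z) ->
  ((p ^ k)%N %| det2 z u)%Z -> ((p ^ k)%N %| det2 z w)%Z ->
  ((p ^ k)%N %| det2 u w)%Z.
Proof.
move=> zn /(primitive_coords _ zn)[z1 z2] zu zw.
rewrite -(Gauss_dvdzr _ (coprime_ppow _ z1)).
have -> : z.1 * det2 u w = u.1 * det2 z w - w.1 * det2 z u by rewrite /det2; ring.
by rewrite rpredB // dvdz_mull.
Qed.
End PrimePower.

(** At most k + 1 values for the exponent of p common to both coordinates, and for each of them two
    classes exchanged by conjugation. *)
Definition classes_weight (k : nat) : nat := if k is 0 then 1 else k.+1.*2.

(** Points are sorted by the power p^l dividing both coordinates. Divided by p^l they are primitive
    of norm n / p^(2 l), and each of them or its conjugate is proportional to a fixed one. Keeping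
    the most frequent level, then the larger class, costs the two factors of [classes_weight]. *)
Lemma prime_power_class (p : nat) (n : nat) (s : seq (int * int)) :
  (prime p -> (3 < p)%N) -> (0 < n)%N -> (forall z, z \in s -> norm3 z = n) ->
  exists2 r : seq (int * int), subseq r s &
    (size s <= classes_weight (logn p n) * size r)%N /\
    {in r &, forall z w, ((p ^ logn p n)%N %| det2 z w)%Z}.
Proof.
move=> p3' n_gt0 sn; case E : (logn p n) => [|k'].
  by exists s; rewrite ?mul1n //; split=> // z w _ _; rewrite dvdzE dvd1n.
have pp : prime p by move: (lognE p n); rewrite E; case: (prime p).
have p3 := p3' pp; rewrite -E; set k := logn p n.
have [s0|s0] := eqVneq s [::].
  by exists s => //; rewrite s0; split.
have pn0 : (p%:Z != 0) by rewrite eqz_nat -lt0n prime_gt0.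
pose lev (z : int * int) := logn p (gcdn `|z.1|%N `|z.2|%N).
have levP z : z \in s -> exists2 zeta : int * int,
     z = ((p ^ lev z)%N%:Z * zeta.1, (p ^ lev z)%N%:Z * zeta.2) &
     ~~ ((p %| zeta.1)%Z && (p %| zeta.2)%Z).
  move=> zs.
  have g_gt0 : (0 < gcdn `|z.1|%N `|z.2|%N)%N.
    rewrite gcdn_gt0 !absz_gt0 -negb_and; apply/negP => /andP[/eqP z1 /eqP z2].
    by have := sn z zs; rewrite /norm3 z1 z2; move: n_gt0; lia.
  have d1 : ((p ^ lev z)%N %| z.1)%Z.
    by rewrite dvdzE /=; apply: dvdn_trans (pfactor_dvdnn _ _) (dvdn_gcdl _ _).
  have d2 : ((p ^ lev z)%N %| z.2)%Z.
    by rewrite dvdzE /=; apply: dvdn_trans (pfactor_dvdnn _ _) (dvdn_gcdr _ _).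
  case/dvdzP: (d1) => a1 e1; case/dvdzP: (d2) => a2 e2.
  exists (a1, a2); first by rewrite /= (mulrC _ a1) (mulrC _ a2) -e1 -e2 -surjective_pairing.
  apply/negP => /andP[/= /dvdzP[b1 f1] /dvdzP[b2 f2]].
  have : (p ^ (lev z).+1 %| gcdn `|z.1|%N `|z.2|%N)%N.
    rewrite dvdn_gcd e1 e2 f1 f2 !abszM /= !expnS -!mulnA.
    by apply/andP; split; apply: dvdn_mull.
  by rewrite pfactor_dvdn // ltnn.
pose conj (z : int * int) := (z.1, - z.2).
have det_scale (c : int) (a b : int * int) :
    det2 (c * a.1, c * a.2) (c * b.1, c * b.2) = c ^+ 2 * det2 a b.
  by rewrite /det2 /=; ring.
have norm_scale (c : int) (a : int * int) :
    norm3 (c * a.1, c * a.2) = c ^+ 2 * norm3 a.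
  by rewrite /norm3 /=; ring.
have lev2 z : z \in s -> (2 * lev z <= k)%N.
  move=> zs; have [a za _] := levP z zs; have := sn z zs.
  rewrite {1}za norm_scale => e; rewrite /k -pfactor_dvdn // mulnC expnM.
  have -> : ((p ^ lev z) ^ 2 %| n)%N = (((p ^ lev z)%N%:Z ^+ 2) %| n%:Z)%Z.
    by rewrite dvdzE abszX.
  by rewrite -e dvdz_mulr.
have [|l sl] := @pigeonhole_filter _ k.+1 s lev _ s0.
  by move=> z /lev2; lia.
set s1 := [seq z <- s | lev z == l] in sl.
have s1P z : z \in s1 -> exists2 a : int * int,
     z = ((p ^ l)%N%:Z * a.1, (p ^ l)%N%:Z * a.2) & ~~ ((p %| a.1)%Z && (p %| a.2)%Z).
  by rewrite mem_filter => /andP[/eqP <-]; exact: levP.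
have s1n z : z \in s1 -> norm3 z = n by rewrite mem_filter => /andP[_]; exact: sn.
have s1s : subseq s1 s by exact: filter_subseq.
have wE : classes_weight k = k.+1.*2 by rewrite /k E.
have s10 : s1 != [::].
  by apply/negP => /eqP s10; move: sl s0; rewrite s10 muln0 leqn0 size_eq0 => ->.
pose z0 := head (0, 0) s1.
have z0s : z0 \in s1 by rewrite /z0; case: (s1) s10 => // z t _; rewrite mem_head.
have l2 : (2 * l <= k)%N.
  by move: z0s; rewrite mem_filter => /andP[/eqP <-]; exact: lev2.
pose P : int := (p ^ l)%N.
have P0 : P ^+ 2 != 0 by rewrite expf_neq0 // eqz_nat -lt0n expn_gt0 prime_gt0.
have pkE : (p ^ k)%N%:Z = P ^+ 2 * (p ^ (k - 2 * l))%N%:Z.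
  by rewrite /P expr2 -!PoszM -!expnD; congr (Posz (p ^ _)%N); lia.
(* If 2 l = k, the common factor p^l alone makes every determinant divisible by p^k. *)
have [k1|k1] := posnP (k - 2 * l).
  exists s1; rewrite // wE; split; first by apply: leq_trans sl _; rewrite leq_mul // -addnn leq_addr.
  move=> z w /s1P[a -> _] /s1P[b -> _].
  by rewrite det_scale pkE k1 expn0 mulr1 dvdz_mulr.
have [a0 z0E a0p] := s1P z0 z0s.
pose n1 := norm3 a0.
have nE : n%:Z = P ^+ 2 * n1 by rewrite -(s1n z0 z0s) {1}z0E norm_scale.
have pk1 : ((p ^ (k - 2 * l))%N %| n1)%Z.
  have : ((p ^ k)%N %| n%:Z)%Z by rewrite dvdzE /= pfactor_dvdnn.
  by rewrite pkE nE dvdz_mul2l.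
have s1a z : z \in s1 -> exists a : int * int,
   [/\ z = (P * a.1, P * a.2), ~~ ((p %| a.1)%Z && (p %| a.2)%Z) & norm3 a = n1].
  move=> zs; have [a za ap] := s1P z zs; exists a; split => //.
  by apply: (mulfI P0); rewrite -nE -(s1n z zs) za norm_scale.
pose sg (z : int * int) := nat_of_bool ((p ^ k)%N %| det2 z0 z)%Z.
have [|b sb] := @pigeonhole_filter _ 2 s1 sg _ s10.
  by move=> z _; rewrite /sg; case: (_ %| _)%Z.
exists [seq z <- s1 | sg z == b]; first exact: subseq_trans (filter_subseq _ _) s1s.
split.
  apply: leq_trans sl _; rewrite wE -mul2n (mulnC 2) -mulnA leq_mul2l.
  by rewrite sb orbT.
move=> z w /[1!mem_filter]/andP[/eqP zb zs] /[1!mem_filter]/andP[/eqP wb ws].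
have sgE : sg z = sg w by rewrite zb wb.
have [a [zE ap an]] := s1a z zs; have [c [wE' cp cn]] := s1a w ws.
have detE u v : ((p ^ k)%N %| det2 (P * u.1, P * u.2) (P * v.1, P * v.2))%Z =
    ((p ^ (k - 2 * l))%N %| det2 u v)%Z.
  by rewrite det_scale pkE dvdz_mul2l.
rewrite zE wE' detE.
have key u v : norm3 u = n1 -> norm3 v = n1 ->
    ~~ ((p %| u.1)%Z && (p %| u.2)%Z) -> ~~ ((p %| v.1)%Z && (p %| v.2)%Z) -> _ :=
  fun un vn => ppow_dvd_det_or_conj _ _ _ pp p3 k1 pk1 u v un vn.
move: sgE; rewrite /sg zE wE' z0E !detE.
case: (boolP (_ %| det2 a0 a)%Z) => h1; case: (boolP (_ %| det2 a0 c)%Z) => h2 // _.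
  exact: (ppow_dvd_det_trans _ _ _ pp p3 k1 pk1 a0).
(* Points outside the class of [a0] have their conjugates inside it, and conjugating both points
   only changes the sign of their determinant. *)
have /orP[|h3] := key a0 a erefl an a0p ap; first by rewrite (negPf h1).
have /orP[|h4] := key a0 c erefl cn a0p cp; first by rewrite (negPf h2).
have := ppow_dvd_det_trans _ _ _ pp p3 k1 pk1 a0 _ _ erefl a0p h3 h4.
rewrite (_ : det2 _ _ = - det2 a c) ?rpredN //.
by rewrite /det2 /=; ring.
Qed.

(* Bounds the number of classes modulo the pi-part of n into which the points of
   norm n fall when the primes of pi exceed 3. *)
Definition kappa (pi : nat_pred) (n : nat) : nat :=
  (\prod_(0 <= p < n.+1 | p \in pi) classes_weight (logn p n))%N.

(** Thinning the sequence prime by prime multiplies the losses; the divisibilities combine since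
    powers of distinct primes are coprime. *)
Lemma divisor_class (pi : nat_pred) (n : nat) (s : seq (int * int)) :
  {in pi, forall p, (3 < p)%N} -> (0 < n)%N -> (forall z, z \in s -> norm3 z = n) ->
  exists2 r : seq (int * int), subseq r s &
    (size s <= kappa pi n * size r)%N /\
    {in r &, forall z w, ((n`_pi)%N %| det2 z w)%Z}.
Proof.
move=> pi3 n_gt0 sn; rewrite /kappa /partn.
have : uniq (index_iota 0 n.+1) by rewrite iota_uniq.
elim: (index_iota 0 n.+1) => [|p ps IH] /= => [_|/andP[pps ups]].
  exists s; rewrite // !big_nil mul1n; split=> // z w _ _; exact: dvd1n.
have [r rs [sr rd]] := IH ups; rewrite !big_cons.
have [ppi|ppi] := ifPn; last by exists r.
have [|||r' r'r [sr' rd']] := prime_power_class p n r.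
- by move=> _; apply: pi3.
- by [].
- by move=> z /(mem_subseq rs); exact: sn.
exists r'; first exact: subseq_trans r'r rs.
split; first by apply: leq_trans sr _; rewrite (mulnC (classes_weight _)) -mulnA leq_mul2l sr' orbT.
move=> z w zr wr; rewrite PoszM Gauss_dvdz; first by rewrite rd' // rd // (mem_subseq r'r).
rewrite coprimezE /= big_seq_cond.
elim/big_rec: _ => [|q m /andP[qps _] cm]; first by rewrite coprimen1.
rewrite coprimeMr cm andbT.
case Ep: (logn p n) => [|i]; first by rewrite coprime1n.
case Eq: (logn q n) => [|j]; first by rewrite coprimen1.
have pp : prime p by move: (lognE p n); rewrite Ep; case: (prime p).
have pq : prime q by move: (lognE q n); rewrite Eq; case: (prime q).
rewrite coprimeXl // coprimeXr // prime_coprime // dvdn_prime2 //.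
by apply: contraNneq pps => ->.
Qed.


(** For a fixed z0 in the class, conj(z0) w has norm (a b)^2 and its sqrt(-3)-coefficient is
    divisible by b, hence so is its rational part [inner w]. The quotient by b has norm a^2,
    determines w, and inherits the smallness of the determinant in its second coordinate. *)
Lemma class_representations (a b : nat) (Delta : nat) (r : seq (int * int)) :
  (0 < a * b)%N -> uniq r ->
  (forall z, z \in r -> norm3 z = (a * b)%N) ->
  {in r &, forall z w, (b %| det2 z w)%Z} ->
  {in r &, forall z w, (`|det2 z w|%N * Delta <= a * b)%N} ->
  exists2 t : seq (int * int), uniq t & size t = size r /\
    forall u, u \in t -> norm3 u = (a ^ 2)%N /\ (`|u.2|%N * Delta <= a)%N.
Proof.
case: r => [|z0 r]; first by exists [::].
move: (z0 :: r) (mem_head z0 r) => {}r z0r ab ur rn rb rD.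
have b_gt0 : (0 < b)%N by move: ab; rewrite muln_gt0 => /andP[].
pose inner (w : int * int) := z0.1 * w.1 + 3 * (z0.2 * w.2).
have normM w : w \in r -> inner w ^+ 2 + 3 * det2 z0 w ^+ 2 = (a * b)%N%:Z ^+ 2.
  move=> wr; transitivity (norm3 z0 * norm3 w).
    by rewrite /inner /det2 /norm3; ring.
  by rewrite (rn z0 z0r) (rn w wr) expr2.
have inner_dvd w : w \in r -> (b %| inner w)%Z.
  move=> wr; rewrite -(@dvdz_pexp2r _ _ 2) //.
  have -> : inner w ^+ 2 = (a * b)%N%:Z ^+ 2 - 3 * det2 z0 w ^+ 2.
    by rewrite -(normM w wr); ring.
  apply: rpredB; first by apply: dvdz_exp2r; rewrite dvdzE /= dvdn_mull.
  by apply: dvdz_mull; apply: dvdz_exp2r; apply: rb.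
pose f w := ((inner w %/ b)%Z, (det2 z0 w %/ b)%Z).
have fE w : w \in r -> inner w = (f w).1 * b /\ det2 z0 w = (f w).2 * b.
  by move=> wr; rewrite /f /= !divzK ?inner_dvd ?rb.
exists (map f r).
  rewrite map_inj_in_uniq // => u v ur' vr fuv.
  have [u1 u2] := fE u ur'; have [v1 v2] := fE v vr.
  have e1 : inner u = inner v by rewrite u1 v1 fuv.
  have e2 : det2 z0 u = det2 z0 v by rewrite u2 v2 fuv.
  have n0 : (a * b)%N%:Z != 0 by rewrite eqz_nat -lt0n.
  have x1 : (a * b)%N%:Z * u.1 = (a * b)%N%:Z * v.1.
    have k w : (a * b)%N%:Z * w.1 = z0.1 * inner w - 3 * z0.2 * det2 z0 w.
      by rewrite -(rn z0 z0r) /inner /det2 /norm3; ring.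
    by rewrite !k e1 e2.
  have x2 : (a * b)%N%:Z * u.2 = (a * b)%N%:Z * v.2.
    have k w : (a * b)%N%:Z * w.2 = z0.2 * inner w + z0.1 * det2 z0 w.
      by rewrite -(rn z0 z0r) /inner /det2 /norm3; ring.
    by rewrite !k e1 e2.
  by move: (mulfI n0 x1) (mulfI n0 x2); case: (u) (v) => [? ?] [? ?] /= -> ->.
rewrite size_map; split=> // _ /mapP[w wr ->].
have [w1 w2] := fE w wr; have b0 : (b%:Z != 0) by rewrite eqz_nat -lt0n.
split.
  apply: (mulIf (expf_neq0 2 b0)); rewrite -[RHS](_ : (a * b)%N%:Z ^+ 2 = _); last first.
    by rewrite PoszM exprMn; congr (_ * _); rewrite expr2 -PoszM mulnn.
  by rewrite -(normM w wr) w1 w2 /norm3; ring.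
have := rD z0 w z0r wr; rewrite w2 abszM /= mulnAC leq_pmul2r //.
Qed.

(** * Solutions of c^2 + 3 d^2 = a^2 *)

Lemma norm3_mul9 (u : int * int) (m : int) : norm3 u = 9 * m ->
  exists2 v : int * int, u = (3 * v.1, 3 * v.2) & norm3 v = m.
Proof.
case: u => x y; rewrite /norm3 /= => e.
have : (3 %| x ^+ 2)%Z by apply/dvdzP; exists (3 * m - y ^+ 2); lia.
rewrite expr2 (@prime_dvdzM 3) // orbb => /dvdzP[x' xE].
have : (3 %| y ^+ 2)%Z by apply/dvdzP; exists (m - x' ^+ 2); move: e; rewrite xE; lia.
rewrite expr2 (@prime_dvdzM 3) // orbb => /dvdzP[y' yE].
exists (x', y'); first by rewrite xE yE /= ![3 * _]mulrC.
by move: e; rewrite xE yE /=; lia.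
Qed.

(** For odd x and y the norm is 4 modulo 8. A norm divisible by 4 therefore need not come from even
    coordinates, as (1, 1) shows, but a norm divisible by 16 does. *)
Lemma norm3_mul16 (u : int * int) (m : int) : norm3 u = 16 * m ->
  exists2 v : int * int, u = (2 * v.1, 2 * v.2) & norm3 v = 4 * m.
Proof.
case: u => x y; rewrite /norm3 /= => e.
have xE := divz_eq x 2; have yE := divz_eq y 2.
have : (0 <= x %% 2 < 2)%Z by rewrite modz_ge0 // ltz_pmod.
have : (0 <= y %% 2 < 2)%Z by rewrite modz_ge0 // ltz_pmod.
set a := (x %/ 2)%Z in xE *; set b := (y %/ 2)%Z in yE *.
set r := (x %% 2)%Z in xE *; set q := (y %% 2)%Z in yE *.
have odd_sq (c : int) : exists h : int, c * (c + 1) = 2 * h.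
  have cE := divz_eq c 2.
  have : (0 <= c %% 2 < 2)%Z by rewrite modz_ge0 // ltz_pmod.
  move: cE; set h := (c %/ 2)%Z; set z := (c %% 2)%Z => cE z2.
  have [z0|z1] : z = 0 \/ z = 1 by lia.
    by exists (h * (c + 1)); rewrite {1}cE z0; ring.
  by exists ((h + 1) * c); rewrite [in c + 1]cE z1; ring.
have [h1 aE] := odd_sq a; have [h2 bE] := odd_sq b.
move=> q2 r2.
have [r0|r1] : r = 0 \/ r = 1 by lia.
  have [q0|q1] : q = 0 \/ q = 1 by lia.
    exists (a, b); first by rewrite xE yE r0 q0 /=; congr (_, _); ring.
    by move: e; rewrite xE yE r0 q0 /=; lia.
  by move: e; rewrite xE yE r0 q1; lia.
have [q0|q1] : q = 0 \/ q = 1 by lia.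
  by move: e; rewrite xE yE r1 q0; lia.
exfalso; have e' : 4 * (a * (a + 1)) + 12 * (b * (b + 1)) + 4 = 16 * m.
  by rewrite -e xE yE r1 q1; ring.
by move: e'; rewrite aE bE; lia.
Qed.

Lemma norm3_eq4 (u : int * int) : norm3 u = 4 ->
  u \in [:: (2, 0); (-2, 0); (1, 1); (1, -1); (-1, 1); (-1, -1)].
Proof.
case: u => x y; rewrite /norm3 /= => e.
have y1 : `|y| <= 1 by nia.
have x2 : `|x| <= 2 by nia.
have [y0|[y0|y0]] : y = 0 \/ y = 1 \/ y = -1 by lia.
- by subst y; have [->|->] : x = 2 \/ x = -2 by nia.
- by subst y; have [->|->] : x = 1 \/ x = -1 by nia.
- by subst y; have [->|->] : x = 1 \/ x = -1 by nia.
Qed.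

(** This treats the primes excluded from [divisor_class]. Descent removes the factors 3 and 2; what
    remains has norm 1 or 4, and the six points of norm 4 are twice the units of the Eisenstein
    integers. *)
Lemma norm3_smooth (i j : nat) : exists2 t : seq (int * int), (size t <= 6)%N &
  forall u : int * int, norm3 u = (2 ^ i * 3 ^ j)%N%:Z ^+ 2 -> u \in t.
Proof.
elim: j => [|j [t t6 tP]]; last first.
  exists [seq (3 * v.1, 3 * v.2) | v <- t]; first by rewrite size_map.
  move=> u uE; have [|v -> vE] := @norm3_mul9 u ((2 ^ i * 3 ^ j)%N%:Z ^+ 2).
    by rewrite uE expnSr mulnA PoszM; ring.
  by apply/mapP; exists v => //; exact: tP.
rewrite muln1; case: i => [|i].
  exists [:: (1, 0); (-1, 0)] => // -[x y]; rewrite /norm3 /= => e.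
  have -> : y = 0 by nia.
  by have [->|->] // : x = 1 \/ x = -1 by nia.
elim: i => [|i [t t6 tP]].
  by exists [:: (2, 0); (-2, 0); (1, 1); (1, -1); (-1, 1); (-1, -1)] => // u; exact: norm3_eq4.
exists [seq (2 * v.1, 2 * v.2) | v <- t]; first by rewrite size_map.
move=> u uE; have [|v -> vE] := @norm3_mul16 u ((2 ^ i)%N%:Z ^+ 2).
  by rewrite uE 2!expnS !PoszM; ring.
apply/mapP; exists v => //; apply: tP; rewrite vE expnS PoszM; ring.
Qed.

(* The solutions of c^2 + 3 d^2 = a^2 with d > 0, i.e. (a - c)(a + c) = 3 d^2, are
   given by 3 (a - c) = e^2 g, a + c = k^2 g and 3 d = k e g. *)
Definition param_box (M Delta a : nat) : pred ('I_M * 'I_M * 'I_M) :=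
  fun q => let: (g, e, k) := q in
    [&& (0 < g)%N, (0 < e)%N, (0 < k)%N, (e * Delta <= 3 * k)%N &
        (g * (e ^ 2 + 3 * k ^ 2) == 6 * a)%N].
Arguments param_box : clear implicits.

(** e / k is (a - C) / d in lowest terms. With G = gcd(a - C, d), the equation becomes e (a + C) = 3
    k^2 G; coprimality gives that e divides 3 G, and g is the quotient. A short d makes e small
    compared to k. *)
Lemma norm3_square_param (a C d Delta : nat) :
  (C ^ 2 + 3 * d ^ 2 = a ^ 2)%N -> (0 < d)%N -> (d * Delta <= a)%N ->
  exists g e k : nat, [/\ [&& (0 < g)%N, (0 < e)%N & (0 < k)%N],
     (e * Delta <= 3 * k)%N, (k ^ 2 * g = a + C)%N,
     (k * e * g = 3 * d)%N & (e ^ 2 * g + 3 * C = 3 * a)%N].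
Proof.
move=> aE d0 dD.
have Ca : (C < a)%N by nia.
pose s := (a - C)%N; pose G := gcdn s d.
have s0 : (0 < s)%N by rewrite /s; lia.
have G0 : (0 < G)%N by rewrite gcdn_gt0 s0.
pose e := (s %/ G)%N; pose k := (d %/ G)%N.
have sE : s = (e * G)%N by rewrite /e divnK ?dvdn_gcdl.
have dE : d = (k * G)%N by rewrite /k divnK ?dvdn_gcdr.
have e0 : (0 < e)%N by move: s0; rewrite sE; case: (e).
have k0 : (0 < k)%N by move: d0; rewrite dE; case: (k).
have cop : coprime e k.
  rewrite /coprime -(eqn_pmul2r G0) muln_gcdl mul1n -sE -dE; exact: eqxx.
have st : (s * (a + C) = 3 * d ^ 2)%N by rewrite /s; nia.
have eG : (e * (a + C) = k ^ 2 * (3 * G))%N.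
  by apply/eqP; rewrite -(eqn_pmul2r G0); apply/eqP; move: st; rewrite sE dE; nia.
have : (e %| 3 * G)%N.
  rewrite -(@Gauss_dvdr e (k ^ 2)); last by rewrite coprimeXr.
  by rewrite -eG dvdn_mulr.
case/dvdnP => g gE; exists g, e, k.
have g0 : (0 < g)%N by move: gE G0; case: (g) => //; lia.
have tE : (k ^ 2 * g = a + C)%N.
  by apply/eqP; rewrite -(eqn_pmul2l e0); apply/eqP; rewrite eG gE; nia.
have kegE : (k * e * g = 3 * d)%N by rewrite dE; transitivity (k * (g * e))%N; [ring | rewrite -gE; ring].
split=> //; first by rewrite g0 e0 k0.
- have kg : (0 < k * g)%N by rewrite muln_gt0 k0.
  rewrite -(leq_pmul2l kg).
  have -> : (k * g * (3 * k) = 3 * (k ^ 2 * g))%N by ring.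
  have -> : (k * g * (e * Delta) = 3 * (d * Delta))%N by rewrite mulnA (mulnA 3) -kegE; ring.
  by rewrite tE leq_pmul2l // (leq_trans dD) // leq_addr.
- have -> : (e ^ 2 * g = 3 * s)%N by rewrite sE; transitivity (e * (g * e))%N; [ring | rewrite -gE; ring].
  by rewrite -mulnDr /s subnK // ltnW.
Qed.

(** The 2 counts the solutions with d = 0, namely c = a and c = - a; the 4 counts the signs of c and
    d. All parameters are at most 6 a, hence below M. *)
Lemma norm3_square_count (M Delta a : nat) (t : seq (int * int)) :
  (0 < a)%N -> (6 * a < M)%N -> uniq t ->
  (forall u, u \in t -> norm3 u = (a ^ 2)%N /\ (`|u.2|%N * Delta <= a)%N) ->
  (size t <= 2 + 4 * #|param_box M Delta a|)%N.
Proof.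
move=> a0 aM ut tP.
rewrite -(count_predC (fun u => u.2 == 0) t) -!size_filter; apply: leq_add.
  rewrite -[2%N]/(size [:: (a%:Z, 0 : int); (- a%:Z, 0 : int)]).
  apply: uniq_leq_size; first exact: filter_uniq.
  move=> [x y]; rewrite mem_filter /= => /andP[/eqP -> /tP[/= + _]].
  rewrite /norm3 /= expr0n mulr0 addr0 -[(a ^ 2)%N]mulnn PoszM -expr2 => /eqP.
  by rewrite eqf_sqr !inE !xpair_eqE eqxx !andbT.
set t' := [seq _ <- t | _].
pose Q (u : int * int) (q : 'I_M * 'I_M * 'I_M) :=
  [&& q \in param_box M Delta a, (q.2 ^ 2 * q.1.1 == a + `|u.1|)%N
      & (q.2 * q.1.2 * q.1.1 == 3 * `|u.2|)%N].
have exQ u : u \in t' -> exists q, Q u q.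
  rewrite mem_filter => /andP[/= u2 /tP[un uD]].
  have [|||g [e [k [/and3P[g0 e0 k0] eD tE dE sE]]]] :=
      @norm3_square_param a `|u.1|%N `|u.2|%N Delta => //.
  - apply/eqP; rewrite -eqz_nat -un /norm3 PoszD PoszM.
    by rewrite -![(_ ^ 2)%N]mulnn !PoszM -!expr2 !abszE !real_normK ?num_real.
  - by rewrite absz_gt0.
  have E : (g * (e ^ 2 + 3 * k ^ 2) = 6 * a)%N.
    have -> : (g * (e ^ 2 + 3 * k ^ 2) = e ^ 2 * g + 3 * (k ^ 2 * g))%N by ring.
    by rewrite tE; lia.
  have gM : (g < M)%N.
    by apply: leq_ltn_trans aM; rewrite -E leq_pmulr // addn_gt0 expn_gt0 e0.
  have eM : (e < M)%N.
    apply: leq_ltn_trans aM; rewrite -E (leq_trans _ (leq_pmull _ g0)) //.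
    by rewrite (leq_trans _ (leq_addr _ _)) // -mulnn leq_pmulr.
  have kM : (k < M)%N.
    apply: leq_ltn_trans aM; rewrite -E (leq_trans _ (leq_pmull _ g0)) //.
    rewrite (leq_trans _ (leq_addl _ _)) // -mulnn mulnA leq_pmull // muln_gt0.
    by [].
  exists (Ordinal gM, Ordinal eM, Ordinal kM).
  by rewrite /Q unfold_in /= g0 e0 k0 eD E tE dE !eqxx.
pose F (u : int * int) : bool * bool * ('I_M * 'I_M * 'I_M) :=
  (0 <= u.1, 0 <= u.2, odflt (Ordinal (leq_ltn_trans (leq0n _) aM),
     Ordinal (leq_ltn_trans (leq0n _) aM), Ordinal (leq_ltn_trans (leq0n _) aM))
     [pick q | Q u q]).
have FQ u : u \in t' -> Q u (F u).2.
  move=> /exQ[q Qq]; rewrite /F /=; case: pickP => [//|/(_ q)]; by rewrite Qq.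
have Finj : {in t' &, injective F}.
  move=> u v ut' vt' Fuv.
  have := FQ u ut'; have := FQ v vt'; rewrite -Fuv.
  case/and3P=> _ /eqP v1 /eqP v2 /and3P[_ /eqP u1 /eqP u2].
  have e1 : `|u.1|%N = `|v.1|%N by apply/eqP; rewrite -(eqn_add2l a) -u1 -v1.
  have e2 : `|u.2|%N = `|v.2|%N by apply/eqP; rewrite -(@eqn_pmul2l 3) // -u2 -v2.
  case: Fuv => s1 s2 _; move: e1 e2 s1 s2; case: (u) (v) => [x y] [x' y'] /=.
  by move=> *; congr (_, _); lia.
have -> : (4 * #|param_box M Delta a| =
    #|[pred q : bool * bool * ('I_M * 'I_M * 'I_M) | param_box M Delta a q.2]|)%N.
  rewrite (@eq_card _ _ (predX predT (param_box M Delta a))) ?cardX; last first.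
    by move=> [x y]; rewrite !inE.
  by congr (_ * _)%N; rewrite card_prod card_bool.
rewrite -(size_map F) -(card_uniqP _) ?map_inj_in_uniq ?filter_uniq //.
apply: subset_leq_card; apply/fintype.subsetP => _ /mapP[u ut' ->].
by have /and3P[] := FQ u ut'.
Qed.

(** * Rankin's bound for smooth divisors *)

(** Legendre's formula for the exponent of p in y!, of which only the first term is kept. *)
Lemma prod_primes_le_fact (y : nat) :
  (\prod_(0 <= p < y.+1 | prime p) p ^ (y %/ p) <= y`!)%N.
Proof.
rewrite -[leqRHS](partnT (fact_gt0 y)) /partn.
rewrite [leqRHS](@big_cat_nat _ _ _ y.+1) //=; last by rewrite ltnS fact_geq.
rewrite -[leqLHS]muln1 leq_mul //; last first.
  rewrite big_seq_cond; elim/big_ind: _ => [//|m n m0 n0|p]; first by rewrite muln_gt0 m0.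
  by rewrite mem_index_iota expn_gt0 => /andP[/andP[yp _] _]; rewrite (leq_ltn_trans (leq0n y)).
rewrite [leqLHS]big_mkcond /=.
apply: leq_prod => p _.
case: ifP => pp; last by rewrite lognE pp.
rewrite leq_pexp2l ?prime_gt0 // logn_fact // .
case: y => [|y]; first by rewrite div0n.
by rewrite big_ltn // expn1 leq_addr.
Qed.

Lemma ln_prod_expn (R : realType) (r : seq nat) (P : pred nat) (e : nat -> nat) :
  (forall p, P p -> (0 < p)%N) ->
  ln (\prod_(p <- r | P p) p ^ e p)%N%:R = \sum_(p <- r | P p) (e p)%:R * ln p%:R :> R.
Proof.
move=> P0; pose K (x : R) (m : nat) := (0 < m)%N /\ ln m%:R = x.
suff [] : K (\sum_(p <- r | P p) (e p)%:R * ln p%:R) (\prod_(p <- r | P p) p ^ e p)%N by [].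
elim/big_rec2: _ => [|p m x /P0 p0 [m0 xE]]; first by rewrite /K ln1.
rewrite /K muln_gt0 expn_gt0 p0 m0; split => //.
by rewrite natrM natrX lnM ?posrE ?exprn_gt0 ?ltr0n // lnXn ?ltr0n // xE mulr_natl.
Qed.

(** A one-sided Mertens estimate, from y! <= y^y; the factor 2 comes from y / p <= 2 floor(y / p)
    for p <= y. *)
Lemma sum_ln_prime_le (R : realType) (y : nat) : (0 < y)%N ->
  \sum_(0 <= p < y.+1 | prime p) ln p%:R / p%:R <= 2 * ln y%:R :> R.
Proof.
move=> y0; have yR : 0 < y%:R :> R by rewrite ltr0n.
have fy : (y`! <= y ^ y)%N.
  elim: (y) => // -[//|m] IH; rewrite factS expnS leq_mul2l (leq_trans IH) ?orbT //.
  by rewrite leq_exp2r.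
have lnle : \sum_(0 <= p < y.+1 | prime p) (y %/ p)%:R * ln p%:R <= y%:R * ln y%:R :> R.
  rewrite -ln_prod_expn; last by move=> p; exact: prime_gt0.
  rewrite mulr_natl -lnXn // -natrX ler_ln ?posrE ?ltr0n ?expn_gt0 ?y0 //; last first.
    rewrite big_seq_cond; elim/big_ind: _ => [//|m n m0 n0|p]; first by rewrite muln_gt0 m0.
    by case/andP=> _ pp; rewrite expn_gt0 prime_gt0.
  rewrite ler_nat; exact: leq_trans (prod_primes_le_fact y) fy.
rewrite -(ler_pM2l yR) mulrCA mulr_sumr.
apply: le_trans (ler_wpM2l (ltW (ltr0n R 2)) lnle); rewrite mulr_sumr.
rewrite big_nat_cond [leRHS]big_nat_cond.
apply: ler_sum => p /andP[/andP[_ py] pp].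
have p0 : 0 < p%:R :> R by rewrite ltr0n prime_gt0.
have lnp : 0 <= ln p%:R :> R by rewrite ln_ge0 // ler1n prime_gt0.
rewrite mulrCA [leLHS]mulrC mulrA ler_wpM2r // ler_pdivrMr // -!natrM ler_nat.
have := divn_eq y p; have := ltn_pmod y (prime_gt0 pp).
have : (0 < y %/ p)%N by rewrite divn_gt0 ?prime_gt0.
by move: (y %/ p)%N (y %% p)%N => q r; nia.
Qed.

(** Take the largest divisor of m that is at most D: one more prime factor, which is at most y,
    overshoots D. *)
Lemma dvdn_between (y D m : nat) : (0 < D)%N -> (D < m)%N ->
  (forall p, prime p -> (p %| m)%N -> (p <= y)%N) ->
  exists2 d : nat, (d %| m)%N & (d <= D < d * y)%N.
Proof.
move=> D0 Dm my; have m0 : (0 < m)%N by exact: leq_trans Dm.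
have ex1 : exists d, (d %| m)%N && (d <= D)%N by exists 1; rewrite dvd1n.
have ub d : (d %| m)%N && (d <= D)%N -> (d <= D)%N by case/andP.
case: (ex_maxnP ex1 ub) => d /andP[dm dD] dmax; exists d; rewrite // dD /=.
have d0 : (0 < d)%N by exact: dvdn_gt0 dm.
case/dvdnP: (dm) => q mE.
have q1 : (1 < q)%N by move: Dm dD; rewrite mE; nia.
have pp := pdiv_prime q1; have pq := pdiv_dvd q.
have pdm : (pdiv q * d %| m)%N by rewrite mE dvdn_mul.
have py : (pdiv q <= y)%N by apply: my => //; exact: dvdn_trans (dvdn_mulr _ _) pdm.
apply: leq_trans (_ : (pdiv q * d <= _)%N); last by rewrite mulnC leq_mul.
rewrite ltnNge; apply/negP => le; have := dmax _ (introT andP (conj pdm le)).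
by have := prime_gt1 pp; nia.
Qed.

(** The induction on L carries the distance e < d from the end of the interval to the next multiple
    of d, so that count * d <= L + e. *)
Lemma count_multiples (n0 L d : nat) : (0 < d <= L)%N ->
  (count (fun n => d %| n)%N (iota n0 L) * d <= 2 * L)%N.
Proof.
case/andP=> d0 dL.
suff [e [ed [_ ce]]] : exists e, (e < d)%N /\ (d %| n0 + L + e)%N /\
    (count (fun n => d %| n)%N (iota n0 L) * d <= L + e)%N by lia.
elim: L {dL} => [|m [e [ed [de ce]]]].
  exists ((d - n0 %% d) %% d)%N; split; first by rewrite ltn_mod.
  split=> //; rewrite addn0 /dvdn modnDmr -modnDml subnKC ?modnn // ltnW // ltn_mod //.
rewrite -addn1 iotaD count_cat /= addn0.
case: e ed de ce => [|e] ed de ce.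
  exists d.-1; split; first by rewrite prednK.
  have -> : (d %| n0 + m)%N by rewrite -[(n0 + m)%N]addn0.
  split; last by rewrite mulnDl mul1n; lia.
  rewrite (_ : (_ + _)%N = n0 + m + 0 + d)%N; last by lia.
  by rewrite dvdn_addl.
exists e; split; first exact: ltnW.
split; first by rewrite (_ : (_ + _)%N = n0 + m + e.+1)%N //; lia.
have -> : (d %| n0 + m)%N = false.
  by apply/negP => h; move: de; rewrite dvdn_addr // => /dvdn_leq; lia.
by rewrite addn0; lia.
Qed.

Definition upto (y : nat) : nat_pred := [pred p | (p <= y)%N].

Lemma prod_partn_upto (y m : nat) : (0 < m)%N ->
  (forall p, prime p -> (p %| m)%N -> (p <= y)%N) ->
  (\prod_(i < y.+1) i ^ logn i m)%N = m.
Proof.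
move=> m0 my; rewrite -[RHS](partnT m0) (@widen_partn (maxn m y)) ?leq_maxl //.
rewrite -(big_mkord predT (fun i => i ^ logn i m)%N).
rewrite (big_nat_widen _ _ (maxn m y).+1) ?ltnS ?leq_maxr //.
rewrite [LHS]big_mkcond /= [RHS]big_mkcond /=; apply: eq_bigr => p _.
case: ifP => // py; case E: (logn p m) => [|k]; first by rewrite expn0.
have pp : prime p by move: (lognE p m); rewrite E; case: (prime p).
have pm : (p %| m)%N by move: (lognE p m); rewrite E; case: (_ %| _)%N; rewrite ?andbF.
by move: (my p pp pm) py; rewrite -ltnS => ->.
Qed.

Lemma powR_exprn (R : realType) (x y : R) (n : nat) : 0 <= x ->
  (x ^+ n) `^ y = (x `^ y) ^+ n.
Proof.
by move=> x0; rewrite -(powR_mulrn n x0) -(powR_mulrn n (powR_ge0 x y)) powRAC.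
Qed.

Section Rankin.
Variables (R : realType) (y D : nat) (eta : R).
Hypotheses (y0 : (0 < y)%N) (D0 : (0 < D)%N) (eta0 : 0 < eta) (eta1 : eta <= 2^-1).

Let w (p : nat) : R := p%:R `^ eta.

(* Chosen so that the sum of g p j over j <= v is p ^ (eta v). *)
Let g (p j : nat) : R :=
  if prime p then (if j is j'.+1 then w p ^+ j - w p ^+ j' else 1) else (j == 0)%:R.

Let w_ge1 (p : nat) : prime p -> 1 <= w p.
Proof.
move=> pp; have -> : 1 = 1 `^ eta :> R by rewrite powR1.
by apply: (ge0_ler_powR (ltW eta0)); rewrite ?nnegrE ?ler01 ?ler0n // ler1n prime_gt0.
Qed.

Let g_ge0 (p j : nat) : 0 <= g p j.
Proof.
rewrite /g; case: ifP => [pp|_]; last by rewrite ler0n.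
case: j => [|j]; first exact: ler01.
by rewrite subr_ge0 exprS ler_peMl ?w_ge1 // exprn_ge0 // powR_ge0.
Qed.

Let sum_g (p v : nat) : prime p -> \sum_(j < v.+1) g p j = w p ^+ v.
Proof.
move=> pp; elim: v => [|v IH]; first by rewrite big_ord_recl big_ord0 addr0 /g pp.
by rewrite big_ord_recr IH /= /g pp; ring.
Qed.

(** Divisors are enumerated by exponent functions, so that sums of products factor by
    distributivity. Nonprime indices do no harm: [g] vanishes there on nonzero exponents. *)
Let dv (f : {ffun 'I_y.+1 -> 'I_D.+1}) : nat := (\prod_(i < y.+1) i ^ f i)%N.

Let G (f : {ffun 'I_y.+1 -> 'I_D.+1}) : R := \prod_(i < y.+1) g i (f i).

Let G_ge0 f : 0 <= G f.
Proof. by apply: prodr_ge0 => i _. Qed.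

(** The smooth part has a divisor d with D / y < d <= D, and the sum of [G] over the divisors of d
    is d^eta. Passing to d keeps all divisors at most D, hence at most the length of the interval in
    which they are counted. *)
Let rankin_lower (n : nat) : (D < n`_(upto y))%N ->
  (D%:R / y%:R) `^ eta <= \sum_(f | (dv f %| n)%N && (0 < dv f <= D)%N) G f.
Proof.
move=> Dn; have [|d dn /andP[dD Ddy]] := @dvdn_between y D _ D0 Dn.
  move=> p pp pn; have := part_pnat (upto y) n.
  by move/pnatPpi => /(_ p); rewrite mem_primes pp pn part_gt0 => /(_ erefl).
have dn' : (d %| n)%N by apply: dvdn_trans dn (dvdn_part _ _).
have d0 : (0 < d)%N by apply: dvdn_gt0 dn; exact: part_gt0.
have dy : forall p, prime p -> (p %| d)%N -> (p <= y)%N.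
  move=> p pp pd; have := part_pnat (upto y) n.
  move/pnatPpi => /(_ p); rewrite mem_primes pp part_gt0 (dvdn_trans pd dn).
  by move=> /(_ erefl).
pose Q (i : 'I_y.+1) (j : 'I_D.+1) := (j <= logn i d)%N.
have lognD i : (logn i d < D.+1)%N by rewrite ltnS (leq_trans _ dD) // ltnW // ltn_logl.
have sumQ (i : 'I_y.+1) : \sum_(j | Q i j) g i j = w i ^+ (logn i d).
  transitivity (\sum_(j < (logn i d).+1) g i j).
    by rewrite (big_ord_widen _ (fun j => g i j) (lognD i)) /=; apply: eq_bigl => j; rewrite ltnS.
  have [pi|npi] := boolP (prime i); first exact: sum_g.
  by rewrite lognE (negPf npi) /= big_ord_recl big_ord0 addr0 /g (negPf npi) eqxx.
have dE : d%:R `^ eta = \sum_(f in family Q) G f.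
  rewrite /G -(bigA_distr_big_dep Q (fun (i : 'I_y.+1) (j : 'I_D.+1) => g i j)) (eq_bigr _ (fun i _ => sumQ i)).
  rewrite -{1}(prod_partn_upto y d d0 dy).
  elim/big_rec2: _ => [|i x m _ <-]; first by rewrite powR1.
  rewrite natrM powRM ?ler0n // natrX; congr (_ * _).
  exact: powR_exprn.
apply: le_trans (_ : d%:R `^ eta <= _).
  apply: (ge0_ler_powR (ltW eta0)); rewrite ?nnegrE ?divr_ge0 ?ler0n //.
  by rewrite ler_pdivrMr ?ltr0n // -natrM ler_nat ltnW.
rewrite dE big_mkcond [leRHS]big_mkcond; apply: ler_sum => f _.
case: ifP => [fQ|_]; last by case: ifP.
have fd : (dv f %| d)%N.
  rewrite -(prod_partn_upto y d d0 dy) /dv.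
  elim/big_ind2: _ => // [*|i _]; first exact: dvdn_mul.
  by apply: dvdn_exp2l; move/familyP: fQ => /(_ i).
rewrite (dvdn_trans fd dn') (dvdn_gt0 d0 fd) /= (leq_trans _ dD) //.
exact: dvdn_leq.
Qed.

Let g_factor (p : nat) : \sum_(j < D.+1) g p j / p%:R ^+ j <=
  if prime p then 1 + 4 * ((w p - 1) / p%:R) else 1.
Proof.
case: ifP => pp; last first.
  rewrite big_ord_recl expr0 divr1 big1 ?addr0 /g ?pp // => i _.
  by rewrite /= mul0r.
have p0 : 0 < p%:R :> R by rewrite ltr0n prime_gt0.
have p2 : 2 <= p%:R :> R by rewrite ler_nat prime_gt1.
rewrite big_ord_recl expr0 divr1 {1}/g pp lerD2l.
set u := w p / p%:R.
have w0 := w_ge1 p pp.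
have u0 : 0 <= u by rewrite divr_ge0 ?ltW // (lt_le_trans ltr01).
(* As eta <= 1/2, u^2 <= 1 / p <= 1/2 < 9/16. The geometric series of ratio u is then at most 4, the
   constant of the statement. *)
have u34 : u <= 3 / 4.
  have : w p ^+ 2 <= p%:R.
    rewrite -powR_mulrn ?powR_ge0 // -powRrM -{2}(powRr1 (ltW p0)).
    by rewrite ler_powR ?(le_trans _ p2) ?ler1n //; move: eta1; lra.
  rewrite /u ler_pdivrMr // => h.
  rewrite -(@ler_pXn2r _ 2) ?nnegrE //; try lra.
  by apply: le_trans h _; nra.
rewrite (eq_bigr (fun j : 'I_D => (w p - 1) / p%:R * u ^+ j)); last first.
  move=> j _; rewrite lift0 /g pp /u expr_div_n !exprS.
  have pj : p%:R ^+ j != 0 :> R by rewrite expf_neq0 // gt_eqF.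
  by field; rewrite pj gt_eqF.
rewrite -mulr_sumr mulrC; apply: ler_wpM2r; first by rewrite divr_ge0 ?(ltW p0) // subr_ge0.
have : (1 - u) * \sum_(j < D) u ^+ j <= 1.
  by rewrite -opprB mulNr -subrX1 opprB lerBlDr lerDl exprn_ge0.
have : 0 <= \sum_(j < D) u ^+ j by apply: sumr_ge0 => j _; exact: exprn_ge0.
nra.
Qed.

(** Each n counted contributes at least (D / y)^eta to the double sum over n and its divisors.
    Exchanging the sums gives at most 2 L / d multiples of each d, and the sum of G / d is an Euler
    product. *)
Lemma rankin_count (n0 L : nat) : (D <= L)%N ->
  (count (fun n => D < n`_(upto y))%N (iota n0 L))%:R * (D%:R / y%:R) `^ eta <=
  2 * L%:R * \prod_(0 <= p < y.+1 | prime p) (1 + 4 * ((w p - 1) / p%:R)).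
Proof.
move=> DL.
apply: le_trans (_ : \sum_(n <- iota n0 L)
    \sum_(f | (dv f %| n)%N && (0 < dv f <= D)%N) G f <= _).
  rewrite -sum1_count natr_sum mulr_suml big_mkcond; apply: ler_sum => n _.
  case: ifP => [Dn|_]; first by rewrite mul1r rankin_lower.
  by apply: sumr_ge0 => f _; exact: G_ge0.
rewrite (exchange_big_dep predT) //=.
apply: le_trans (_ : \sum_(f : {ffun 'I_y.+1 -> 'I_D.+1}) 2 * L%:R * \prod_(i < y.+1) (g i (f i) / i%:R ^+ f i) <= _).
  apply: ler_sum => f _; have prodE : \prod_(i < y.+1) (g i (f i) / i%:R ^+ f i) = G f / (dv f)%:R.
    rewrite /G /dv prodf_div natr_prod; congr (_ / _); apply: eq_bigr => i _.
    by rewrite natrX.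
  rewrite prodE; have [fD|fD] := boolP (0 < dv f <= D)%N; last first.
    rewrite big_pred0; last by move=> n; rewrite andbF.
    by rewrite !mulr_ge0 ?invr_ge0 ?ler0n ?G_ge0.
  rewrite (eq_bigl (fun n => dv f %| n)%N); last by move=> n; rewrite andbT.
  rewrite big_const_seq iter_addr_0 -[leLHS]mulr_natr [leRHS]mulrCA ler_wpM2l ?G_ge0 //.
  have [f0 fD'] := andP fD.
  rewrite ler_pdivlMr ?ltr0n // -natrM -natrM ler_nat.
  by apply: count_multiples; rewrite f0 (leq_trans fD').
rewrite -mulr_sumr; apply: ler_wpM2l; first by rewrite mulr_ge0 ?ler0n.
rewrite -(bigA_distr_bigA (fun (i : 'I_y.+1) (j : 'I_D.+1) => g i j / i%:R ^+ j)).
rewrite [leRHS]big_mkcond [leRHS]big_mkord; apply: ler_prod => i _ /=.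
rewrite g_factor andbT; apply: sumr_ge0 => j _.
by rewrite divr_ge0 ?g_ge0 ?exprn_ge0 ?ler0n.
Qed.

(** From 1 - x <= exp(- x), w p - 1 <= eta ln p * w p <= eta ln p * y^eta; the sum of ln p / p is
    then bounded by [sum_ln_prime_le]. *)
Lemma rankin_prod_le :
  \prod_(0 <= p < y.+1 | prime p) (1 + 4 * ((w p - 1) / p%:R)) <=
  expR (8 * (eta * ln y%:R) * y%:R `^ eta).
Proof.
apply: le_trans (_ : expR (4 * (eta * y%:R `^ eta) *
    \sum_(0 <= p < y.+1 | prime p) ln p%:R / p%:R) <= _); last first.
  rewrite ler_expR; have := sum_ln_prime_le R y y0.
  set S := \sum_(_ <= _ < _ | _) _ => SE.
  rewrite [leRHS](_ : _ = 4 * (eta * y%:R `^ eta) * (2 * ln y%:R)); last by ring.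
  by rewrite ler_wpM2l // !mulr_ge0 ?powR_ge0 // ltW.
rewrite mulr_sumr expR_sum big_nat_cond [leRHS]big_nat_cond.
apply: ler_prod => p /andP[/andP[_ py] pp].
have p0 : 0 < p%:R :> R by rewrite ltr0n prime_gt0.
have w1 := w_ge1 p pp.
apply/andP; split; first by rewrite addr_ge0 // mulr_ge0 // divr_ge0 ?subr_ge0 // ltW.
apply: le_trans (expR_ge1Dx _); rewrite lerD2l -mulrA ler_wpM2l // mulrA ler_wpM2r ?invr_ge0 ?(ltW p0) //.
have wE : w p = expR (eta * ln p%:R) by rewrite /w /powR gt_eqF.
have wy : w p <= y%:R `^ eta.
  by apply: (ge0_ler_powR (ltW eta0)); rewrite ?nnegrE ?ler0n // ler_nat -ltnS.
have lnp : 0 <= ln p%:R :> R by rewrite ln_ge0 // ler1n prime_gt0.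
have t0 : 0 <= eta * ln p%:R by rewrite mulr_ge0 // ltW.
apply: le_trans (_ : eta * ln p%:R * w p <= _); last first.
  by rewrite mulrAC ler_wpM2r // ler_wpM2l // ltW.
have := expR_ge1Dx (- (eta * ln p%:R)); rewrite expRN -wE => h.
have : (1 - eta * ln p%:R) * w p <= (w p)^-1 * w p by rewrite ler_wpM2r // (le_trans ler01).
rewrite mulVf ?gt_eqF ?(lt_le_trans ltr01) //; lra.
Qed.

End Rankin.

Lemma rankin_smooth (R : realType) (y D L n0 : nat) (eta : R) :
  (0 < y)%N -> (0 < D <= L)%N -> 0 < eta -> eta <= 2^-1 ->
  (count (fun n => D < n`_(upto y))%N (iota n0 L))%:R * (D%:R / y%:R) `^ eta <=
  2 * L%:R * expR (8 * (eta * ln y%:R) * y%:R `^ eta).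
Proof.
move=> y0 /andP[D0 DL] eta0 eta1; apply: le_trans (rankin_count R y D eta _ _ _ _ n0 L DL) _ => //.
by rewrite ler_wpM2l ?mulr_ge0 ?ler0n // rankin_prod_le.
Qed.

(** * Points on short arcs of a thin annulus *)

Lemma classes_weight_le4 (k : nat) : (classes_weight k <= 4 ^ k)%N.
Proof.
case: k => // k; rewrite /classes_weight; elim: k => // k IH.
by rewrite expnS; move: IH; rewrite -!mul2n; lia.
Qed.

Lemma classes_weight_gt0 (k : nat) : (0 < classes_weight k)%N.
Proof. by case: k. Qed.

(** A prime p > 2^(2^t) satisfies 4^(2^t) <= p^2. So the weight raised to the power 2^t is at most
    the square of the rough part of n, hence at most 4^(2^s). *)
Lemma kappa_rough_le (s t n : nat) : (t <= s)%N -> (0 < n <= 2 ^ 2 ^ s)%N ->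
  (kappa (upto (2 ^ 2 ^ t))^' n <= 4 ^ 2 ^ (s - t))%N.
Proof.
move=> ts /andP[n0 ns].
have t0 : (0 < 2 ^ t)%N by rewrite expn_gt0.
rewrite -(@leq_exp2r _ _ (2 ^ t)) // -expnM -expnD subnK //.
apply: leq_trans (_ : (n`_(upto (2 ^ 2 ^ t))^' ^ 2 <= _)%N); last first.
  rewrite (_ : 4 = 2 ^ 2)%N // -expnM mulnC expnM leq_exp2r //.
  by rewrite (leq_trans _ ns) // dvdn_leq // dvdn_part.
rewrite /kappa /partn; elim/big_ind2: _ => [|m1 m2 k1 k2 h1 h2|p py]; first by rewrite !exp1n.
  by rewrite !expnMn leq_mul.
apply: leq_trans (_ : ((4 ^ logn p n) ^ 2 ^ t <= _)%N).
  by rewrite leq_exp2r // classes_weight_le4.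
rewrite (_ : 4 = 2 ^ 2)%N // -!expnM (mulnC 2) expnM [leqRHS]expnM leq_exp2r //.
rewrite mulnC expnM; case: (logn p n) => // k; rewrite leq_exp2r //.
by move: py; rewrite !inE -ltnNge => /ltnW.
Qed.

(** Each prime up to 2^(2^mu) costs at most 2^(s+2), and the larger ones are left to
    [kappa_rough_le]. This serves the n with large smooth part; for mu = g + 14 the second factor is
    2^(2^(s-g-13)), a small power of D. *)
Lemma kappa_le (s mu n : nat) (pi : nat_pred) : (mu <= s)%N -> (0 < n <= 2 ^ 2 ^ s)%N ->
  (kappa pi n <= 2 ^ ((s + 2) * (2 ^ 2 ^ mu).+1 + 2 * 2 ^ (s - mu)))%N.
Proof.
move=> mus ns; rewrite expnD (expnM 2 2) [(2 ^ 2)%N]/=.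
apply: leq_trans (leq_mul (leqnn _) (kappa_rough_le s mu n mus ns)).
set Y := (2 ^ 2 ^ mu)%N; have [n0 n_le] := andP ns.
have prod0 r P : (0 < \prod_(p <- r | P p) classes_weight (logn p n))%N.
  by apply: prodn_cond_gt0 => p _; exact: classes_weight_gt0.
have wide : (kappa pi n <= \prod_(0 <= p < maxn Y.+1 n.+1) classes_weight (logn p n))%N.
  rewrite /kappa (big_nat_widen _ _ (maxn Y.+1 n.+1)) ?leq_maxr // big_mkcond.
  by apply: leq_prod => p _; case: ifP => // _; exact: classes_weight_gt0.
apply: leq_trans wide _; rewrite (@big_cat_nat _ _ _ Y.+1) ?leq_maxl //; apply: leq_mul.
  rewrite expnM -[in leqRHS](subn0 Y.+1) -prod_nat_const_nat.
  apply: leq_prod => p _; case E : (logn p n) => [|k]; first by rewrite expn_gt0.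
  have pp : prime p by move: (lognE p n); rewrite E; case: (prime p).
  have : (k.+1 <= 2 ^ s)%N.
    rewrite -(@leq_exp2l 2) // (leq_trans _ n_le) // -E.
    apply: leq_trans (_ : (p ^ logn p n <= _)%N).
      by rewrite E leq_exp2r ?prime_gt1.
    by rewrite dvdn_leq // pfactor_dvdnn.
  have : (0 < 2 ^ s)%N by rewrite expn_gt0.
  by rewrite /classes_weight -mul2n expnD; lia.
rewrite /kappa.
have [Yn|Yn] := leqP n.+1 Y.+1.
  by rewrite big_geq.
rewrite [leqRHS](@big_cat_nat _ _ _ Y.+1) ?(ltnW Yn) //=.
rewrite -[leqLHS]mul1n leq_mul //.
rewrite big_nat_cond [leqRHS]big_nat_cond [leqRHS]big_mkcond [leqLHS]big_mkcond /=.
apply: leq_prod => p _; rewrite !inE -ltnNge andbT.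
by case: (Y < p)%N; case: (p < n.+1)%N.
Qed.

Lemma fibre_le (s t n Delta M : nat) (r : seq (int * int)) :
  (0 < t <= s)%N -> (0 < n <= 2 ^ 2 ^ s)%N -> uniq r ->
  (6 * n`_(upto (2 ^ 2 ^ t)) < M)%N ->
  (forall z, z \in r -> norm3 z = n) ->
  {in r &, forall z w, (`|det2 z w|%N * Delta <= n)%N} ->
  (size r <= 4 ^ 2 ^ (s - t) *
     (2 + 4 * #|param_box M Delta n`_(upto (2 ^ 2 ^ t))|))%N.
Proof.
move=> /andP[t0 ts] ns ur aM rn rD; have [n0 _] := andP ns.
set pi := upto (2 ^ 2 ^ t) in aM *.
have nE : n = (n`_pi * n`_pi^')%N by rewrite partnC.
have [|||q qr [rq qd]] := divisor_class (pi^')%N n r => //.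
  (* Since t > 0, 2^(2^t) is at least 4, so the primes of the rough part exceed 3. *)
  move=> p; rewrite !inE -ltnNge; apply: leq_trans.
  by apply: leqW; rewrite -[4%N]/(2 ^ 2 ^ 1)%N leq_exp2l // leq_exp2l.
apply: leq_trans rq (leq_mul (kappa_rough_le s t n ts ns) _).
have uq := subseq_uniq qr ur.
have qs := mem_subseq qr.
have [|||||w uw [<- wP]] := class_representations (n`_pi)%N (n`_pi^')%N Delta q => //.
- by rewrite -nE.
- by move=> z /qs/rn ->; rewrite -nE.
- by move=> z w /qs zr /qs wr; rewrite -nE; exact: rD.
by apply: norm3_square_count => //; exact: part_gt0.
Qed.

(** A bound without any condition on the arc: all primes above 3 go into the modulus, [Delta] is 0,
    and each class has at most the six points of [norm3_smooth]. *)
Lemma fibre_le_kappa (n : nat) (r : seq (int * int)) : (0 < n)%N -> uniq r ->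
  (forall z, z \in r -> norm3 z = n) ->
  (size r <= kappa (upto 3)^' n * 6)%N.
Proof.
move=> n0 ur rn; set pi := upto 3.
have nE : n = (n`_pi * n`_pi^')%N by rewrite partnC.
have [|||q qr [rq qd]] := divisor_class (pi^')%N n r => //.
  by move=> p; rewrite !inE -ltnNge.
apply: leq_trans rq _; rewrite leq_mul2l; apply/orP; right.
have uq := subseq_uniq qr ur.
have qs := mem_subseq qr.
have [|||||w uw [<- wP]] := class_representations (n`_pi)%N (n`_pi^')%N 0 q => //.
- by rewrite -nE.
- by move=> z /qs/rn ->; rewrite -nE.
- by move=> z v _ _; rewrite muln0.
have [T T6 TP] := norm3_smooth (logn 2 n`_pi)%N (logn 3 n`_pi)%N.
apply: leq_trans T6; apply: uniq_leq_size => // u /wP[uE _]; apply: TP.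
rewrite uE -mulnn PoszM -expr2; congr (Posz _ ^+ 2).
rewrite -[LHS](prod_partn_upto 3) ?part_gt0 //.
  have log0 : logn 0 n`_pi = 0%N by rewrite lognE.
  by rewrite !big_ord_recr big_ord0 /= log0 expn0 exp1n !mul1n.
move=> p pp pd; have := part_pnat pi n.
by move/pnatPpi => /(_ p); rewrite mem_primes pp part_gt0 pd => /(_ erefl).
Qed.

(** Rankin's bound with eta = c / 2^t, for which y^eta = 2^c; the hypothesis 2 c <= 2^t is eta <=
    1/2. The exponent 16 is twice the 8 of [rankin_smooth], from exp 1 <= 4. *)
Lemma rankin_pow2 (R : realType) (t d c L n0 : nat) :
  (0 < c)%N -> (2 * c <= 2 ^ t)%N -> (t <= d)%N -> (2 ^ 2 ^ d <= L)%N ->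
  (count (fun n => 2 ^ 2 ^ d < n`_(upto (2 ^ 2 ^ t)))%N (iota n0 L) *
     2 ^ (c * (2 ^ (d - t) - 1)) <= 2 * L * 2 ^ (16 * c * 2 ^ c))%N.
Proof.
move=> c0 ct td dL.
have two0 : 0 < 2 :> R by [].
have t0 : 0 < (2 ^ t)%N%:R :> R by rewrite ltr0n expn_gt0.
pose eta : R := c%:R / (2 ^ t)%N%:R.
have eta0 : 0 < eta by rewrite divr_gt0 // ltr0n.
have eta1 : eta <= 2^-1.
  rewrite /eta ler_pdivrMr //.
  have : (2 * c)%N%:R <= (2 ^ t)%N%:R :> R by rewrite ler_nat.
  rewrite natrM; lra.
have etaM : eta * (2 ^ t)%N%:R = c%:R by rewrite /eta mulfVK // gt_eqF.
have y0 : (0 < 2 ^ 2 ^ t)%N by rewrite expn_gt0.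
have DL : (0 < 2 ^ 2 ^ d <= L)%N by rewrite expn_gt0.
have := rankin_smooth R _ _ L n0 eta y0 DL eta0 eta1.
set K := count _ _.
have yE : (2 ^ 2 ^ t)%N%:R `^ eta = (2 ^ c)%N%:R :> R.
  by rewrite !natrX -!powR_mulrn // -powRrM mulrC etaM.
have DyE : ((2 ^ 2 ^ d)%N%:R / (2 ^ 2 ^ t)%N%:R) `^ eta = (2 ^ (c * (2 ^ (d - t) - 1)))%N%:R :> R.
  have -> : (2 ^ 2 ^ d)%N%:R / (2 ^ 2 ^ t)%N%:R = 2 ^+ (2 ^ t * (2 ^ (d - t) - 1)) :> R.
    rewrite !natrX -expfB_cond ?mulnBr ?muln1 -?expnD ?subnKC // ?pnatr_eq0 //.
    by rewrite leq_exp2l ?addn0.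
  rewrite natrX -!powR_mulrn // -powRrM; congr (_ `^ _).
  by rewrite !natrM mulrC mulrA etaM.
rewrite yE DyE -natrM => h; rewrite -(ler_nat R); apply: le_trans h _.
rewrite [leRHS]natrM natrM ler_wpM2l ?mulr_ge0 ?ler0n //.
apply: le_trans (_ : expR ((8 * c * 2 ^ c)%N%:R) <= _).
  rewrite ler_expR !natrM ler_wpM2r ?ler0n // ler_wpM2l ?ler0n //.
  rewrite natrX lnXn // mulrnAr -mulrnAl -mulr_natr etaM ler_piMr ?ler0n //.
  by have := le_ln1Dx (x := 1 : R); rewrite -[1 + 1]/(2 : R); apply; lra.
rewrite -[X in expR X]mul1r expRM powR_mulrn ?expR_ge0 // (_ : 16 = 2 * 8)%N // -!mulnA.
rewrite expnM natrX lerXn2r ?nnegrE ?expR_ge0 ?ler0n //.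
have h2 : expR (- 2^-1) >= 2^-1 :> R by have := expR_ge1Dx (- 2^-1 : R); lra.
have : expR (- 2^-1) * expR (- 2^-1) * expR 1 = 1 :> R.
  by rewrite -!expRD (_ : _ + _ = 0) ?expR0 //; lra.
have := expR_gt0 (1 : R); rewrite [(2 ^ 2)%N]/=.
have : 4^-1 <= expR (- 2^-1) * expR (- 2^-1) :> R by nra.
move: (expR _ * expR _) => a; nra.
Qed.

Lemma harmonic_pow2 (m : nat) : \sum_(1 <= g < 2 ^ m) (g%:R)^-1 <= m%:R :> rat.
Proof.
elim: m => [|m IH]; first by rewrite big_geq.
have e0 : (0 < 2 ^ m)%N by rewrite expn_gt0.
rewrite (@big_cat_nat _ _ _ (2 ^ m)) ?leq_exp2l //= -[m.+1]addn1 natrD lerD //.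
apply: le_trans (_ : \sum_(2 ^ m <= g < 2 ^ (m + 1)) ((2 ^ m)%N%:R)^-1 <= _).
  rewrite big_nat_cond [leRHS]big_nat_cond; apply: ler_sum => g /andP[/andP[mg _] _].
  by rewrite lef_pV2 ?posrE ?ltr0n ?ler_nat // (leq_trans e0).
rewrite sumr_const_nat addn1 expnS mul2n -addnn addnK -[leLHS]mulr_natr.
by rewrite mulVf // pnatr_eq0 -lt0n.
Qed.

(** A parameter (g, e, k) fixes the value a = g (e^2 + 3 k^2) / 6 >= g k^2 / 2, and n runs through
    multiples of a: at most 2 L / a <= 4 L / (g k^2) of them. There are at most 3 k / Delta choices
    of e, which leaves two harmonic sums over g and k, each at most m. *)
Lemma sum_param_box_le (m D L n0 Delta : nat) (a : nat -> nat) :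
  (0 < Delta)%N -> (D <= L)%N -> ((6 * D).+1 <= 2 ^ m)%N ->
  (forall n, (0 < a n)%N && (a n %| n)%N) ->
  ((\sum_(n <- iota n0 L | a n <= D) #|param_box (6 * D).+1 Delta (a n)|) * Delta
     <= 12 * L * m ^ 2)%N.
Proof.
move=> Delta0 DL Dm aP; set M := (6 * D).+1.
pose J (q : 'I_M * 'I_M * 'I_M) :=
  [&& (0 < q.1.1)%N, (0 < q.1.2)%N, (0 < q.2)%N & (q.1.2 * Delta <= 3 * q.2)%N].
pose cnt (q : 'I_M * 'I_M * 'I_M) :=
  count (fun n => (a n <= D) && (q \in param_box M Delta (a n)))%N (iota n0 L).
have swap : (\sum_(n <- iota n0 L | a n <= D) #|param_box M Delta (a n)| =
    \sum_(q | J q) cnt q)%N.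
  rewrite (eq_bigr (fun n => \sum_(q | J q && (q \in param_box M Delta (a n))) 1)%N); last first.
    move=> n _; rewrite -sum1_card; apply: eq_bigl => -[[g e] k].
    rewrite /J !unfold_in /=; case: (0 < g)%N; case: (0 < e)%N => //=.
    by case: (0 < k)%N => //=; case: (_ <= _)%N.
  rewrite (exchange_big_dep J) /=; last by move=> n q _ /andP[].
  apply: eq_bigr => q Jq; rewrite /cnt -sum1_count; apply: eq_bigl => n.
  by rewrite Jq.
have cntP q : J q -> (cnt q * (q.1.1 * q.2 ^ 2) <= 4 * L)%N.
  case: q => [[g e] k]; rewrite /J /cnt /= => /and4P[g0 e0 k0 eD].
  have [/hasP[n _ /andP[nD]]|/hasPn H] :=
    boolP (has (fun n => (a n <= D) && ((g, e, k) \in param_box M Delta (a n)))%N (iota n0 L)); last first.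
    rewrite (_ : count _ _ = 0)%N //; apply/eqP; rewrite -leqn0 leqNgt -has_count.
    by apply/hasPn.
  rewrite unfold_in /= => /and5P[_ _ _ _ /eqP aE].
  have [an _] := andP (aP n).
  apply: leq_trans (_ : count (fun n' => a n %| n')%N (iota n0 L) * (2 * a n) <= _)%N.
    apply: leq_mul; last by nia.
    apply: sub_count => n' /andP[_]; rewrite unfold_in /= => /and5P[_ _ _ _ /eqP aE'].
    have -> : a n = a n' by lia.
    by case/andP: (aP n').
  have := @count_multiples n0 L (a n); rewrite an (leq_trans nD DL) => /(_ erefl); lia.
rewrite swap -(ler_nat rat) natrM natr_sum.
have Dr : 0 < Delta%:R :> rat by rewrite ltr0n.
rewrite -ler_pdivlMr //.
apply: le_trans (_ : \sum_(q : 'I_M * 'I_M * 'I_M | J q) 4 * L%:R / (q.1.1%:R * q.2%:R ^+ 2) <= _).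
  apply: ler_sum => q Jq; rewrite ler_pdivlMr.
    by rewrite -natrX -!natrM ler_nat cntP.
  by case/and4P: Jq => g0 _ k0 _; rewrite mulr_gt0 ?exprn_gt0 ?ltr0n.
apply: le_trans (_ : \sum_(g < M | (0 < g)%N) \sum_(k < M | (0 < k)%N)
    \sum_(e < M | (0 < e)%N && (e * Delta <= 3 * k)%N) 4 * L%:R / (g%:R * k%:R ^+ 2) <= _).
  rewrite pair_big_dep /= pair_big_dep /=.
  rewrite (reindex (fun q : 'I_M * 'I_M * 'I_M => (q.1.1, q.2, q.1.2))) /=; last first.
    exists (fun q : 'I_M * 'I_M * 'I_M => (q.1.1, q.2, q.1.2)); by move=> [[? ?] ?].
  rewrite le_eqVlt; apply/orP; left; apply/eqP; apply: eq_bigl => -[[g k] e].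
  by rewrite /J /= -!andbA; case: (0 < g)%N; case: (0 < e)%N; case: (0 < k)%N.
apply: le_trans (_ : \sum_(g < M | (0 < g)%N) \sum_(k < M | (0 < k)%N)
    (12 * L%:R / Delta%:R) * (g%:R^-1 * k%:R^-1) <= _).
  apply: ler_sum => g g0; apply: ler_sum => k k0.
  have gr : 0 < g%:R :> rat by rewrite ltr0n.
  have kr : 0 < k%:R :> rat by rewrite ltr0n.
  rewrite sumr_const -[leLHS]mulr_natr.
  set c := #|_|.
  have cD : (c * Delta <= 3 * k)%N.
    rewrite -leq_divRL // /c -sum1_card.
    rewrite -(big_mkord (fun e => (0 < e) && (e * Delta <= 3 * k))%N (fun=> 1%N)).
    rewrite sum1_count -size_filter -[leqRHS](size_iota 1).
    apply: uniq_leq_size; first by rewrite filter_uniq // iota_uniq.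
    move=> e; rewrite mem_filter mem_iota -andbA => /and3P[e0 eD _].
    by rewrite e0 add1n ltnS leq_divRL.
  rewrite [leLHS](_ : _ = 4 * L%:R * (g%:R^-1 * (k%:R^-1 ^+ 2)) * c%:R); last first.
    by rewrite invfM exprVn.
  have cr : c%:R * Delta%:R <= 3 * k%:R :> rat by rewrite -!natrM ler_nat.
  have cr' : c%:R <= 3 * k%:R / Delta%:R :> rat by rewrite ler_pdivlMr.
  apply: le_trans (ler_wpM2l _ cr') _; first by rewrite !mulr_ge0 ?invr_ge0 ?ler0n ?exprn_ge0 ?invr_ge0 ?ler0n.
  rewrite le_eqVlt; apply/orP; left; apply/eqP; field.
  by rewrite !gt_eqF.
rewrite (eq_bigr (fun g : 'I_M => (12 * L%:R / Delta%:R) * g%:R^-1 *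
    \sum_(k < M | (0 < k)%N) k%:R^-1)); last first.
  by move=> g _; rewrite mulr_sumr; apply: eq_bigr => k _; rewrite mulrA.
rewrite -mulr_suml -mulr_sumr.
have H : \sum_(k < M | (0 < k)%N) k%:R^-1 <= m%:R :> rat.
  rewrite -(big_mkord (fun k => 0 < k)%N (fun k => k%:R^-1)).
  rewrite big_ltn_cond //= big_nat_cond.
  rewrite (eq_bigl (fun k => (1 <= k < M)%N)); last first.
    by move=> k; case: k => // k; rewrite andbT.
  rewrite -big_nat; apply: le_trans (harmonic_pow2 m).
  rewrite [leRHS](@big_cat_nat _ _ _ M) //= lerDl; apply: sumr_ge0 => k _.
  by rewrite invr_ge0 ler0n.
have H0 : 0 <= \sum_(k < M | (0 < k)%N) k%:R^-1 :> rat.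
  by apply: sumr_ge0 => k _; rewrite invr_ge0 ler0n.
set S := \sum_(k < M | _) _ in H H0 *.
rewrite [leRHS](_ : _ = 12 * L%:R / Delta%:R * m%:R * m%:R); last first.
  by rewrite -mulnn !natrM mulrAC mulrA.
have : 0 <= 12 * L%:R / Delta%:R :> rat by rewrite divr_ge0 ?ler0n // mulr_ge0 ?ler0n.
move: (12 * _ / _) => c c0; move: S (m%:R) H H0 => S m' H H0.
by apply: ler_pM => //; [exact: mulr_ge0 | exact: ler_wpM2l].
Qed.

(** The bounds B / 2, B / 4, ... add up to at most B. *)
Lemma sum_geometric_le (m n s B : nat) (X : nat -> nat) : (n <= s)%N ->
  (forall i, (m <= i < n)%N -> (X i * 2 ^ (s - i) <= B)%N) ->
  (\sum_(m <= i < n) X i <= B)%N.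
Proof.
move=> ns XB; suff : ((\sum_(m <= i < n) X i) * 2 ^ (s - n) <= B)%N.
  by apply: leq_trans; rewrite leq_pmulr // expn_gt0.
elim: n ns XB => [|n IH] ns XB; first by rewrite big_geq.
have [mn|nm] := leqP m n; last by rewrite big_geq.
have h1 : ((\sum_(m <= i < n) X i) * 2 ^ (s - n) <= B)%N.
  apply: IH => [|i /andP[mi iN]]; first exact: ltnW.
  by apply: XB; rewrite mi ltnS ltnW.
have h2 : (X n * 2 ^ (s - n) <= B)%N by apply: XB; rewrite mn ltnSn.
rewrite big_nat_recr //=.
have E : (s - n)%N = (s - n.+1).+1 by lia.
by move: h1 h2; rewrite E expnS; nia.
Qed.

(** The main term on the left is 2^(s-g-13). On the right, 2^t <= 160 s gives (s %/ 4) 2^(s-g-t) >=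
    2^(s-g-10), eight times as much; the shift 14 in the cutoff comes from here. The other terms are
    of order s 2^(s/4), since 2^(g+14) <= s / 4. *)
Lemma rankin_exponent_le (g s t : nat) : (2 ^ (g + 18) <= s)%N -> (2 ^ t <= 160 * s)%N ->
  (t + g <= s)%N ->
  ((s + 2) * (2 ^ 2 ^ (g + 14)).+1 + 2 * 2 ^ (s - (g + 14)) +
   16 * (s %/ 4) * 2 ^ (s %/ 4) <= (s %/ 4) * (2 ^ (s - g - t) - 1))%N.
Proof.
move=> s0 ts tgs; set q := (s %/ 4)%N.
have q0 : (2 ^ (g + 16) <= q)%N.
  by rewrite /q leq_divRL // -[4%N]/(2 ^ 2)%N -expnD -addnA.
have sq : (4 * q <= s <= 4 * q + 3)%N.
  by have := divn_eq s 4; have := ltn_pmod s (isT : (0 < 4)%N); rewrite -/q; lia.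
have qq : (q < 2 ^ q)%N by exact: ltn_expl.
have gq : (g + 16 <= q)%N by apply: leq_trans q0; apply: ltnW; exact: ltn_expl.
have YE : (2 ^ 2 ^ (g + 14) <= 2 ^ q)%N.
  by rewrite leq_exp2l // (leq_trans _ q0) // leq_exp2l // leq_add2l.
set U := (2 ^ (s - g - t))%N.
have UE : (U * 2 ^ t = 2 ^ (s - g))%N by rewrite /U -expnD subnK //; lia.
have sgE : (2 ^ (s - g) = 2 ^ 10 * 2 ^ (s - g - 10))%N by rewrite -expnD; congr (_ ^ _)%N; lia.
have qU : (2 ^ (s - g - 10) <= q * U)%N.
  rewrite -(@leq_pmul2l (2 ^ 10)) // -sgE -UE.
  apply: leq_trans (leq_mul (leqnn _) ts) _.
  by rewrite mulnC mulnA leq_mul2r; apply/orP; right; lia.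
have E1 : (2 * 2 ^ (s - (g + 14)) = 2 ^ (s - g - 13))%N by rewrite -expnS; congr (_ ^ _)%N; lia.
have E2 : (2 ^ (s - g - 10) = 8 * 2 ^ (s - g - 13))%N.
  by rewrite -[8%N]/(2 ^ 3)%N -expnD; congr (_ ^ _)%N; lia.
have E3 : (2 ^ 5 * (2 ^ q * 2 ^ q) <= 4 * 2 ^ (s - g - 13))%N.
  by rewrite -[4%N]/(2 ^ 2)%N -!expnD leq_exp2l //; lia.
have h1 : ((s + 2) * (2 ^ 2 ^ (g + 14)).+1 <= (5 * q + 2) * (2 * 2 ^ q))%N.
  by apply: leq_mul; lia.
have h2 : (q * 2 ^ q <= 2 ^ q * 2 ^ q)%N by rewrite leq_mul2r (ltnW qq) orbT.
have h3 : (q * 1 <= q * 2 ^ q)%N by rewrite leq_mul2l (leq_trans _ qq) ?orbT.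
have h4 : (1 * 2 ^ q <= q * 2 ^ q)%N by rewrite leq_mul2r; apply/orP; right; lia.
rewrite mulnBr muln1 E1.
have {}h1 : ((s + 2) * (2 ^ 2 ^ (g + 14)).+1 <= 14 * (q * 2 ^ q))%N by apply: leq_trans h1 _; lia.
have E16 : (16 * q * 2 ^ q = 16 * (q * 2 ^ q))%N by rewrite mulnA.
rewrite E16; rewrite [(2 ^ 5)%N]/= in E3; lia.
Qed.

(* The primes up to 2^2^t' with t <= t' < s - g serve as smoothness levels. Level t'
   is used when it is the last one whose smooth part is at most D = 2^2^(s-g); the
   part of n made of larger primes then has at most 2^(s-t') prime factors. *)
Lemma lattice_count (R : realType) (g : nat) : (0 < g)%N -> exists C : nat,
  forall (s t L n0 Delta : nat) (r : seq (int * int)),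
  (2 ^ (g + 18) <= s)%N -> (80 * s <= 2 ^ t <= 160 * s)%N -> (2 ^ 2 ^ (s - g) <= L)%N ->
  (4 ^ 2 ^ (s - t) * 2 ^ (4 * s) <= Delta)%N -> uniq r ->
  (forall z, z \in r -> exists2 n : nat, norm3 z = n &
     (0 < n <= 2 ^ 2 ^ s)%N && (n0 <= n < n0 + L)%N) ->
  {in r &, forall z w, norm3 z = norm3 w -> (`|det2 z w|%N * Delta <= `|norm3 z|%N)%N} ->
  (size r <= C * L)%N.
Proof.
(* A Rankin exponent for which c (u - 1) >= 3 * 2^(s-t') as soon as u = 2^(s-g-t'-1) >= 2. The
   saving 2^(c (u - 1)) then covers the weight 4^(2^(s-t')) and a further factor 2^(s-t') that makes
   the sum over t' geometric. *)
move=> g0; pose c := (3 * 2 ^ (g + 2))%N.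
have [K1 K1E] : exists k, k = (2 * 4 ^ 2 ^ (g + 1))%N by eexists.
have [K2 K2E] : exists k, k = (4 * 2 ^ (16 * c * 2 ^ c))%N by eexists.
(* The summands bound in turn the four terms of [fibP], summed over n. *)
exists (12 + K1 + K2 + 48)%N.
move=> s t L n0 Delta r s0 /andP[ts1 ts2] DL DeltaP ur rn rD.
set D := (2 ^ 2 ^ (s - g))%N in DL; set M := (6 * D).+1; set tm := (s - g - 1)%N.
have gs : (g + 18 <= s)%N by apply: leq_trans s0; apply: ltnW; exact: ltn_expl.
have tm1 : (t + g + 2 <= s)%N.
  rewrite -(@leq_exp2l 2) // -addnA expnD.
  apply: leq_trans (leq_mul ts2 (leqnn _)) _.
  have e18 : (2 ^ 16 * 2 ^ (g + 2) = 2 ^ (g + 18))%N by rewrite -expnD; congr (_ ^ _)%N; lia.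
  have s2 : (s * s <= 2 ^ s)%N.
    have : (4 <= s)%N by lia.
    elim: (s) => // k IH; rewrite leq_eqVlt => /orP[/eqP <- //|]; rewrite ltnS => k4.
    by have := IH k4; rewrite expnS; nia.
  apply: leq_trans s2; rewrite mulnAC mulnC leq_mul2l; apply/orP; right.
  by apply: leq_trans s0; rewrite -e18 leq_mul2r; apply/orP; right.
have t0 : (0 < t)%N by case: (t) ts1 => //; lia.
have Delta0 : (0 < Delta)%N by apply: leq_trans DeltaP; rewrite muln_gt0 !expn_gt0.
pose a (t' n : nat) := (n`_(upto (2 ^ 2 ^ t')))%N.
pose fib (n : nat) := [seq z <- r | norm3 z == n].
have sizeE : (size r = \sum_(n <- iota n0 L) size (fib n))%N.
  have : all (fun z => `|norm3 z|%N \in iota n0 L) r.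
    by apply/allP => z /rn[n nz /andP[_ nI]]; rewrite nz mem_iota.
  have : all (fun z => norm3 z == `|norm3 z|%N) r.
    by apply/allP => z /rn[n nz _]; rewrite nz.
  rewrite /fib; elim: (r) => [|z r' IH] /=; first by rewrite big1.
  case/andP=> /eqP zn r1 /andP[zI r2]; rewrite (IH r1 r2).
  rewrite (bigD1_seq _ zI (iota_uniq _ _)) /= [in RHS](bigD1_seq _ zI (iota_uniq _ _)) /=.
  rewrite zn absz_nat eqxx /= addSn; congr (_ + _).+1.
  apply: eq_bigr => n nz; rewrite zn eqz_nat eq_sym (negPf nz) //.
(* [E] pays, with the worst-case weight of [kappa_le], for n whose smooth part exceeds D already at
   level t; [Q] for the solutions with d = 0 at a level that is not the last; [P] for the solutions
   with d <> 0. *)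
pose Kx := ((s + 2) * (2 ^ 2 ^ (g + 14)).+1 + 2 * 2 ^ (s - (g + 14)))%N.
pose E n := if (D < a t n)%N then (6 * 2 ^ Kx)%N else 0%N.
pose Q t' n := if (D < a t'.+1 n)%N then (2 * 4 ^ 2 ^ (s - t'))%N else 0%N.
pose P t' n := if (a t' n <= D)%N then
  (4 * 4 ^ 2 ^ (s - t') * #|param_box M Delta (a t' n)|)%N else 0%N.
have fibP n : (size (fib n) <= E n + K1 +
   \sum_(t <= t' < tm) Q t' n + \sum_(t <= t' < tm.+1) P t' n)%N.
  have [->//|fib0] := eqVneq (fib n) [::].
  have fib_n z : z \in fib n -> norm3 z = n by rewrite mem_filter => /andP[/eqP].
  have fib_r z : z \in fib n -> z \in r by rewrite mem_filter => /andP[].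
  have nX : (0 < n <= 2 ^ 2 ^ s)%N.
    case E0: (fib n) fib0 => [//|z l] _.
    have zf : z \in fib n by rewrite E0 mem_head.
    have [n' zn' /andP[nX _]] := rn z (fib_r z zf).
    by move: zn'; rewrite (fib_n z zf) => /eqP; rewrite eqz_nat => /eqP ->.
  have [np nX'] := andP nX.
  have uf : uniq (fib n) by exact: filter_uniq.
  have [big|small] := ltnP D (a t n).
    apply: leq_trans (_ : 6 * 2 ^ Kx <= _)%N; last first.
      by rewrite -!addnA; apply: leq_trans (leq_addr _ _); rewrite /E big.
    apply: leq_trans (fibre_le_kappa n _ np uf fib_n) _.
    by rewrite mulnC leq_mul2l /=; apply: kappa_le => //; lia.
  have step t' : (t <= t' <= tm)%N -> (a t' n <= D)%N ->
      (size (fib n) <= 2 * 4 ^ 2 ^ (s - t') + P t' n)%N.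
    move=> /andP[tt' t'm] aD; rewrite /P aD.
    apply: leq_trans (fibre_le s t' n Delta M _ _ nX uf _ fib_n _) _.
    - by apply/andP; split; [exact: leq_trans tt' | rewrite /tm in t'm; lia].
    - by rewrite ltnS leq_mul2l.
    - move=> z w zf wf; have zr := fib_r z zf; have wr := fib_r w wf.
      have := rD z w zr wr; rewrite (fib_n z zf) (fib_n w wf) absz_nat; exact.
    by rewrite mulnDr mulnC mulnCA mulnA.
  have exP : exists t', [&& t <= t', t' <= tm & a t' n <= D]%N.
    by exists t; rewrite leqnn small andbT /=; rewrite /tm; lia.
  have ubP t' : [&& t <= t', t' <= tm & a t' n <= D]%N -> (t' <= tm)%N by case/and3P.
  case: (ex_maxnP exP ubP) => t' /and3P[tt' t'm aD] t'max.
  have Pin : (P t' n <= \sum_(t <= i < tm.+1) P i n)%N.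
    have t'I : t' \in index_iota t tm.+1 by rewrite mem_index_iota tt' ltnS.
    by rewrite (bigD1_seq _ t'I (iota_uniq _ _)) /= leq_addr.
  have := step t' _ aD; rewrite tt' t'm => /(_ erefl) sz; apply: leq_trans sz _.
  (* At the last level s - t' = g + 1, so the weight is the constant [K1]. At an earlier one,
     maximality of t' makes the smooth part exceed D at level t' + 1. *)
  move: t'm; rewrite leq_eqVlt => /orP[/eqP t'E|t'm].
    have -> : (2 * 4 ^ 2 ^ (s - t') = K1)%N.
      by rewrite t'E /tm K1E; congr (2 * 4 ^ 2 ^ _)%N; lia.
    apply: leq_add Pin; rewrite -addnA; apply: leq_trans (leq_addl _ _).
    by rewrite leq_addr.
  have aD' : (D < a t'.+1 n)%N.
    rewrite ltnNge; apply/negP => h; have := t'max t'.+1.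
    by rewrite h t'm ltnn (leq_trans tt') // => /(_ erefl).
  have Qin : (2 * 4 ^ 2 ^ (s - t') <= \sum_(t <= i < tm) Q i n)%N.
    have t'I : t' \in index_iota t tm by rewrite mem_index_iota tt'.
    by rewrite (bigD1_seq _ t'I (iota_uniq _ _)) /= {1}/Q aD' leq_addr.
  apply: leq_add Pin; apply: leq_trans Qin _; exact: leq_addl.
rewrite sizeE; apply: leq_trans (leq_sum _ (fun n _ => fibP n)) _.
rewrite !big_split /= !mulnDl.
have sum_if (b : pred nat) (k : nat) :
    (\sum_(n <- iota n0 L) (if b n then k else 0) = count b (iota n0 L) * k)%N.
  by rewrite -big_mkcond big_const_seq iter_addn_0 mulnC.
apply: leq_add; [apply: leq_add; [apply: leq_add|]|].
(* The exponent s / 4 is large enough to beat 2^Kx and small enough to keep 2^(16 q 2^q)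
   negligible. *)
- rewrite sum_if; set q := (s %/ 4)%N.
  have := rankin_pow2 R t (s - g) q L n0.
  have q0 : (0 < q)%N by rewrite divn_gt0 //; lia.
  have q2 : (2 * q <= 2 ^ t)%N.
    by apply: leq_trans ts1; have := leq_trunc_div s 4; rewrite -/q; lia.
  have tsg : (t <= s - g)%N by lia.
  move=> /(_ q0 q2 tsg DL); rewrite -/D.
  have := rankin_exponent_le g s t s0 ts2; rewrite -/q -/Kx.
  have tgs : (t + g <= s)%N by lia.
  move=> /(_ tgs); rewrite -(@leq_exp2l 2) // expnD.
  set W := (2 ^ (q * (_ - 1)))%N; set V := (2 ^ (16 * q * _))%N.
  have V0 : (0 < V)%N by rewrite expn_gt0.
  move: (2 ^ Kx)%N => KK.
  set cnt := count _ _ => KV; rewrite -/(a t) => cW.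
  have : (cnt * KK * V <= 2 * L * V)%N.
    by apply: leq_trans cW; rewrite -mulnA leq_mul2l KV orbT.
  rewrite leq_pmul2r //;   lia.
- by rewrite big_const_seq count_predT size_iota iter_addn_0.
- rewrite exchange_big K2E.
  apply: (@sum_geometric_le _ _ s); first by rewrite /tm; lia.
  move=> t' /andP[tt' t'm]; rewrite /Q sum_if.
  have c0 : (0 < c)%N by rewrite muln_gt0 expn_gt0.
  have c2 : (2 * c <= 2 ^ t'.+1)%N.
    rewrite expnS leq_mul2l /=; apply: leq_trans (_ : 2 ^ t <= _)%N; last by rewrite leq_exp2l.
    apply: leq_trans ts1; apply: leq_trans (leq_mul (leqnn 80) s0).
    by rewrite /c (_ : g + 18 = 16 + (g + 2))%N ?expnD; lia.
  have t'sg : (t'.+1 <= s - g)%N by rewrite /tm in t'm; lia.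
  have := rankin_pow2 R t'.+1 (s - g) c L n0 c0 c2 t'sg DL; rewrite -/D.
  set u := (2 ^ (s - g - t'.+1))%N.
  have u2 : (2 <= u)%N.
    by apply: (@leq_trans (2 ^ 1)) => //; rewrite /u leq_exp2l //; rewrite /tm in t'm; lia.
  have VE : (2 ^ (s - t') = 2 ^ (g + 1) * u)%N.
    by rewrite /u -expnD; congr (_ ^ _)%N; rewrite /tm in t'm; lia.
  have cu : (3 * 2 ^ (s - t') <= c * (u - 1))%N.
    rewrite VE /c (_ : g + 2 = (g + 1).+1)%N; last by lia.
    by rewrite expnS -!mulnA leq_mul2l /= mulnCA leq_mul2l; apply/orP; right; lia.
  rewrite -/(a t'.+1).
  set cnt := count _ _; set KK := (2 ^ (16 * c * _))%N => cK.
  have V1 : (2 ^ (s - t') <= 2 ^ 2 ^ (s - t'))%N by apply: ltnW; exact: ltn_expl.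
  set V := (2 ^ (s - t'))%N in V1 cu *.
  have h : (4 ^ V * V <= 2 ^ (c * (u - 1)))%N.
    apply: leq_trans (_ : 2 ^ (3 * V) <= _)%N; last by rewrite leq_exp2l.
    rewrite (_ : 3 * V = 2 * V + V)%N; last by lia.
    by rewrite expnD expnM leq_mul2l V1 orbT.
  have : (cnt * (4 ^ V * V) <= 2 * L * KK)%N.
    by apply: leq_trans cK; rewrite leq_mul2l h orbT.
  move: (4 ^ V)%N => F; clear -F; move: cnt V KK => cnt V KK; lia.
- rewrite exchange_big /=.
  rewrite -(leq_pmul2r Delta0) big_distrl /=.
  (* The lowest level has the largest weight. Fewer than 2^s levels, each with the logarithmic
     factor m^2 = (2^s)^2, are covered by the 2^(4 s) in the hypothesis on [Delta]. *)
  apply: leq_trans (_ : \sum_(t <= i < tm.+1) (48 * L * 4 ^ 2 ^ (s - t) * (2 ^ s) ^ 2) <= _)%N.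
    rewrite big_nat_cond [leqRHS]big_nat_cond; apply: leq_sum => t' /andP[/andP[tt' _] _].
    rewrite /P -big_mkcond /= -big_distrr /= -mulnA.
    have Mm : (M <= 2 ^ 2 ^ s)%N.
      have s1 : (2 ^ (s - g) + 3 <= 2 ^ s)%N.
        have : (2 ^ (s - g) <= 2 ^ (s - 1))%N by rewrite leq_exp2l //; lia.
        have : (2 ^ s = 2 * 2 ^ (s - 1))%N by rewrite -expnS; congr (_ ^ _)%N; lia.
        have : (2 ^ 2 <= 2 ^ (s - 1))%N by rewrite leq_exp2l //; lia.
        by rewrite [(2 ^ 2)%N]/=; lia.
      apply: leq_trans (_ : 2 ^ (2 ^ (s - g) + 3) <= _)%N; last by rewrite leq_exp2l.
      rewrite expnD -/D /M [(2 ^ 3)%N]/=.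
      have : (0 < D)%N by rewrite expn_gt0.
      by lia.
    have aP n : (0 < a t' n)%N && (a t' n %| n)%N by rewrite part_gt0 dvdn_part.
    have := sum_param_box_le (2 ^ s) D L n0 Delta (a t') Delta0 DL Mm aP.
    rewrite -/M; set SS := (\sum_(_ <- _ | _) _)%N => h.
    have F : (4 ^ 2 ^ (s - t') <= 4 ^ 2 ^ (s - t))%N by rewrite leq_exp2l // leq_exp2l //; lia.
    apply: leq_trans (leq_mul (leq_mul (leqnn 4) F) h) _.
    by rewrite leq_eqVlt; apply/orP; left; apply/eqP; ring.
  rewrite sum_nat_const_nat.
  apply: leq_trans (_ : 2 ^ s * (48 * L * 4 ^ 2 ^ (s - t) * (2 ^ s) ^ 2) <= _)%N.
    rewrite leq_mul2r; apply/orP; right; apply: leq_trans (ltnW (ltn_expl s _)) => //.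
    by rewrite /tm; lia.
  apply: leq_trans (_ : 48 * L * (4 ^ 2 ^ (s - t) * 2 ^ (4 * s)) <= _)%N; last by rewrite leq_mul2l DeltaP orbT.
  apply: leq_trans (_ : 48 * L * (4 ^ 2 ^ (s - t) * (2 ^ s * (2 ^ s) ^ 2)) <= _)%N.
    by move: (2 ^ s)%N (4 ^ _)%N => A B; rewrite leq_eqVlt; apply/orP; left; apply/eqP; ring.
  rewrite leq_mul2l; apply/orP; right; rewrite leq_mul2l; apply/orP; right.
  by rewrite -expnM -expnD leq_exp2l //; lia.
Qed.

(** * Counting frequency triples *)

(** Here [l] is ln (nu ln 2). From nu = 3 on it is positive because ln 2 >= 1/2, and it is at most
    ln (2^s) <= s; taking logarithms in the hypothesis gives nu <= (nu - mu) l. *)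
Lemma dyadic_gap (R : realType) (nu mu s : nat) : (3 <= nu)%N ->
  (2 ^ mu)%N%:R <= (2 ^ nu)%N%:R *
     expR (- ln (2 ^ nu)%N%:R / ln (ln (2 ^ nu)%N%:R)) :> R ->
  (nu <= 2 ^ s)%N -> (mu <= nu)%N /\ (nu <= (nu - mu) * s)%N.
Proof.
move=> nu3 + nus; have two0 : 0 < 2 :> R by [].
have pos2 k : 0 < 2 ^+ k :> R by rewrite exprn_gt0.
have ln2_ge : 2^-1 <= ln 2 :> R.
  rewrite -[leLHS]expRK ler_ln ?posrE ?expR_gt0 //.
  have := expR_ge1Dx (- 2^-1 : R); rewrite expRN => h.
  rewrite -[leRHS]invrK -[leLHS]invrK lef_pV2 ?posrE ?invr_gt0 ?expR_gt0 //; lra.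
have ln2_le : ln 2 <= 1 :> R.
  by have := @le_ln1Dx R 1; rewrite -[1 + 1]/(2 : R); apply; lra.
have nuR : 3 <= nu%:R :> R by rewrite ler_nat.
rewrite !natrX lnXn // -[ln 2 *+ nu]mulr_natl.
set l := ln (_ * _) => cond.
have l_gt0 : 0 < l by apply: ln_gt0; nra.
have l_le : l <= s%:R.
  apply: le_trans (_ : ln (2 ^+ s) <= _); last first.
    by rewrite lnXn // -[leLHS]mulr_natl ler_piMr ?ler0n.
  rewrite ler_ln ?posrE ?mulr_gt0 ?ltr0n //; [|by lia|by lra].
  apply: le_trans (_ : nu%:R <= _); first by rewrite ler_piMr ?ler0n.
  by rewrite -natrX ler_nat.
have : ln (2 ^+ mu) <= ln (2 ^+ nu * expR (- (nu%:R * ln 2) / l)).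
  by rewrite ler_ln // ?posrE ?mulr_gt0 ?expR_gt0.
rewrite lnM ?posrE ?expR_gt0 // expRK !lnXn // -[ln 2 *+ mu]mulr_natl -[ln 2 *+ nu]mulr_natl => h.
have {}h : nu%:R <= (nu%:R - mu%:R) * l.
  have ln20 : 0 < ln 2 :> R by lra.
  have canc : - (nu%:R * ln 2) / l * l = - (nu%:R * ln 2) :> R by rewrite divfK ?gt_eqF.
  rewrite -(ler_pM2r l_gt0) mulrDl canc in h.
  rewrite -(ler_pM2l ln20); lra.
have munu : (mu <= nu)%N.
  rewrite leqNgt -(ltr_nat R); apply/negP => c; nra.
split=> //; rewrite -(ler_nat R) natrM natrB //; apply: le_trans h _.
by rewrite ler_wpM2l // subr_ge0 ler_nat.
Qed.

Definition triple_sum (k : nat * nat * nat) : nat := (k.1.1 + k.1.2 + k.2)%N.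

Definition triple_sqr (k : nat * nat * nat) : nat :=
  (k.1.1 ^ 2 + k.1.2 ^ 2 + k.2 ^ 2)%N.

Definition dyadic_block (N k : nat) : bool := (N <= 2 * k)%N && (k <= N)%N.

Definition triple_point (k : nat * nat * nat) : int * int :=
  (k.1.1%:Z + k.1.2%:Z - 2 * k.2%:Z, k.1.1%:Z - k.1.2%:Z).

Lemma norm3_triple_point (k : nat * nat * nat) :
  norm3 (triple_point k) = 6 * (triple_sqr k)%:Z - 2 * (triple_sum k)%:Z ^+ 2.
Proof.
case: k => [[a b] c]; rewrite /norm3 /triple_point /triple_sqr /triple_sum /=.
by rewrite -!mulnn !PoszD !PoszM; ring.
Qed.

Lemma triple_point_inj (k l : nat * nat * nat) : triple_sum k = triple_sum l ->
  triple_point k = triple_point l -> k = l.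
Proof.
case: k l => [[a b] c] [[a' b'] c']; rewrite /triple_sum /triple_point /= => S [e1 e2].
have [-> [-> ->]] // : a = a' /\ b = b' /\ c = c' by lia.
Qed.

(** The norm is twice the sum of the squared differences of k1, k2, k3, and k1 - k3 >= N1 / 4. So
    the radius is at least of order N1, while x varies by O(N3) only. *)
Lemma triple_point_norm_ge (N1 k1 k2 k3 : nat) :
  (N1 <= 2 * k1)%N -> (4 * k3 <= N1)%N ->
  (N1%:Z ^+ 2 <= 8 * norm3 (triple_point (k1, k2, k3))).
Proof.
move=> h1 h3; rewrite /norm3 /triple_point /=.
have E : (k1%:Z + k2%:Z - 2 * k3%:Z) ^+ 2 + 3 * (k1%:Z - k2%:Z) ^+ 2 =
  2 * ((k1%:Z - k2%:Z) ^+ 2 + (k1%:Z - k3%:Z) ^+ 2 + (k2%:Z - k3%:Z) ^+ 2) by ring.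
rewrite E; have h : N1%:Z <= 4 * (k1%:Z - k3%:Z) by lia.
have := sqr_ge0 (k1%:Z - k2%:Z); have := sqr_ge0 (k2%:Z - k3%:Z).
have : 0 <= N1%:Z by []. nia.
Qed.

(* On a circle the y-coordinates of two points on the same side of the x-axis
   satisfy (y - y')^2 <= |y^2 - y'^2| = |x^2 - x'^2| / 3. *)
Lemma det2_short_arc (n : nat) (N w e : nat) (x y x' y' : int) :
  norm3 (x, y) = n -> norm3 (x', y') = n -> 0 <= y * y' ->
  `|x - x'| <= 3 * N%:Z -> (N * 2 ^ w)%N%:Z ^+ 2 <= 8 * n%:Z -> (2 * e + 6 <= w)%N ->
  (`|det2 (x, y) (x', y')|%N * 2 ^ e <= n)%N.
Proof.
rewrite /norm3 /det2 /= => xn xn' yy xx NW ew.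
pose P := (2 ^ w)%N%:Z; pose E := (2 ^ e)%N%:Z.
have P0 : 1 <= P by rewrite lez_nat expn_gt0.
have P0' : 0 <= P by exact: le_trans P0.
have E0 : 0 <= E by [].
have EP : 64 * E ^+ 2 <= P.
  have : (2 ^ 6 * (2 ^ e * 2 ^ e) <= 2 ^ w)%N by rewrite -!expnD leq_exp2l //; lia.
  by rewrite [(2 ^ 6)%N]/= /E /P expr2; lia.
(* The squared gaps satisfy a = O(n / P) and b = O(n / P^2), so the determinant is at most of order
   n / P^(1/2), mostly from the y-gap. This is why [Delta] is only about the square root of 2^w. *)
have [a aE] : exists a, a = (y - y') ^+ 2 by eexists.
have [b bE] : exists b, b = (x - x') ^+ 2 by eexists.
have a0 : 0 <= a by rewrite aE sqr_ge0.
have b0 : 0 <= b by rewrite bE sqr_ge0.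
have n0 : 0 <= n%:Z by [].
rewrite PoszM exprMn -/P in NW.
have bN : b <= 9 * N%:Z ^+ 2.
  rewrite bE -real_normK ?num_real // (_ : 9 * N%:Z ^+ 2 = (3 * N%:Z) ^+ 2); last by ring.
  by rewrite ler_pXn2r ?nnegrE ?normr_ge0.
have x2 : x ^+ 2 <= n by have := sqr_ge0 y; lra.
have x2' : x' ^+ 2 <= n by have := sqr_ge0 y'; lra.
have y2 : 3 * y ^+ 2 <= n by have := sqr_ge0 x; lra.
have ab : 9 * a ^+ 2 <= b * (4 * n%:Z).
  have h : a ^+ 2 <= (y ^+ 2 - y' ^+ 2) ^+ 2.
    have -> : (y ^+ 2 - y' ^+ 2) ^+ 2 = a * (a + 4 * (y * y')) by rewrite aE; ring.
    by rewrite expr2 ler_wpM2l // lerDl mulr_ge0.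
  apply: le_trans (ler_wpM2l _ h) _ => //.
  have -> : 9 * (y ^+ 2 - y' ^+ 2) ^+ 2 = (3 * y ^+ 2 - 3 * y' ^+ 2) ^+ 2 by ring.
  have -> : 3 * y ^+ 2 - 3 * y' ^+ 2 = - ((x - x') * (x + x')) by lra.
  rewrite sqrrN exprMn -bE ler_wpM2l //.
  have := sqr_ge0 (x - x'); rewrite !sqrrD ?sqrrB; lra.
have bP : b * P ^+ 2 <= 72 * n%:Z.
  apply: le_trans (ler_wpM2r (sqr_ge0 _) bN) _; rewrite -mulrA.
  lra.
have aP : a * P <= 6 * n%:Z.
  rewrite -(@ler_pXn2r _ 2) ?nnegrE ?(mulr_ge0 a0 P0') ?mulr_ge0 //.
  rewrite !exprMn; apply: le_trans (_ : 32 * n%:Z ^+ 2 <= _); last first.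
    by have := sqr_ge0 n%:Z; lra.
  have : 9 * a ^+ 2 * P ^+ 2 <= b * (4 * n%:Z) * P ^+ 2 by rewrite ler_wpM2r ?sqr_ge0.
  have : b * P ^+ 2 * (4 * n%:Z) <= 72 * n%:Z * (4 * n%:Z) by rewrite ler_wpM2r ?mulr_ge0.
  lra.
have det_le : (x * y' - x' * y) ^+ 2 <= 2 * (x ^+ 2 * a) + 2 * (b * y ^+ 2).
  have -> : x * y' - x' * y = (x - x') * y - x * (y - y') by ring.
  have := sqr_ge0 ((x - x') * y + x * (y - y')); rewrite aE bE; lra.
have detP : (x * y' - x' * y) ^+ 2 * P <= 64 * n%:Z ^+ 2.
  apply: le_trans (ler_wpM2r _ det_le) _; first by lra.
  have h1 : x ^+ 2 * (a * P) <= n%:Z * (6 * n%:Z).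
    by apply: ler_pM => //; [exact: sqr_ge0 | rewrite mulr_ge0 //; lra].
  have h2 : (b * P) * (3 * y ^+ 2) <= 72 * n%:Z * n%:Z.
    apply: ler_pM => //; first by rewrite mulr_ge0 //; lra.
      by rewrite mulr_ge0 ?sqr_ge0.
    apply: le_trans bP; by rewrite ler_wpM2l // expr2 ler_peMl.
  by have := sqr_ge0 n%:Z; lra.
have : (`|x * y' - x' * y| * E) ^+ 2 <= n%:Z ^+ 2.
  rewrite exprMn real_normK ?num_real // -(ler_pM2l (_ : 0 < 64)) //.
  have := ler_wpM2l (sqr_ge0 (x * y' - x' * y)) EP; lra.
by rewrite ler_pXn2r ?nnegrE ?mulr_ge0.
Qed.

Definition triple_window (N1 N2 N3 A m H : nat) (k : nat * nat * nat) : bool :=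
  [&& dyadic_block N1 k.1.1, dyadic_block N2 k.1.2, dyadic_block N3 k.2,
      triple_sum k == A & (m <= triple_sqr k < m + H)%N].

(** k1 and k3 determine k2 through the sum A, so N2, which may be arbitrarily large, does not enter
    the bound. *)
Lemma triple_count_trivial (N1 N2 N3 A m H : nat) (r : seq (nat * nat * nat)) :
  uniq r -> (forall k, k \in r -> triple_window N1 N2 N3 A m H k) ->
  (size r <= N1.+1 * N3.+1)%N.
Proof.
move=> ur rP; pose f (k : nat * nat * nat) := (k.1.1, k.2).
rewrite -(size_map f) -(size_iota 0 N1.+1) -(size_iota 0 N3.+1) -(size_allpairs pair).
apply: uniq_leq_size.
  rewrite map_inj_in_uniq // => -[[a b] c] [[a' b'] c'] /rP + /rP.
  rewrite /triple_window /triple_sum /= => /and5P[_ _ _ /eqP S _] /and5P[_ _ _ /eqP S' _] [e1 e2].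
  by congr (_, _, _) => //; lia.
move=> _ /mapP[k /rP/and5P[/andP[_ a1] _ /andP[_ c1] _ _] ->].
by apply: (@allpairs_f _ _ _ pair); rewrite mem_iota /= ltnS.
Qed.

Lemma sqr_gap (b b' : nat) : (b < b')%N -> (b ^ 2 + b + b' <= b' ^ 2)%N.
Proof. by move=> /subnKC <-; rewrite -!mulnn; move: (b' - b.+1)%N => d; nia. Qed.

(** Squares of distinct k2 are at least N2 > 2 N1^2 apart, more than k1^2 + k3^2 can compensate.
    Then k1 + k3 and k1^2 + k3^2 fix the pair, and k3 < k1 fixes its order. So Q is injective on the
    triples and takes at most H values. *)
Lemma triple_count_far (N1 N2 N3 A m H : nat) (r : seq (nat * nat * nat)) :
  (2 * N1 ^ 2 < N2)%N -> (2 * N3 < N1)%N ->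
  uniq r -> (forall k, k \in r -> triple_window N1 N2 N3 A m H k) ->
  (size r <= H)%N.
Proof.
move=> N12 N13 ur rP.
rewrite -(size_map triple_sqr) -(size_iota m H); apply: uniq_leq_size.
  rewrite map_inj_in_uniq // => -[[a b] c] [[a' b'] c'] /rP + /rP.
  rewrite /triple_window /triple_sum /triple_sqr /dyadic_block /=.
  case/and5P=> /andP[a1 a2] /andP[b1 b2] /andP[c1 c2] /eqP S _.
  case/and5P=> /andP[a1' a2'] /andP[b1' b2'] /andP[c1' c2'] /eqP S' _ Q.
  have sq (u v : nat) : (u <= v)%N -> (u ^ 2 <= v ^ 2)%N by move=> uv; rewrite leq_exp2r.
  have sqa := sq _ _ a2; have sqa' := sq _ _ a2'.
  have sqc : (c ^ 2 <= N1 ^ 2)%N by apply: sq; lia.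
  have sqc' : (c' ^ 2 <= N1 ^ 2)%N by apply: sq; lia.
  have bb : b = b'.
    apply/eqP; apply: contraT => bb.
    wlog lt : a b c a' b' c' a1 a2 b1 b2 c1 c2 S a1' a2' b1' b2' c1' c2' S' Q sqa sqa' sqc sqc' bb / (b < b')%N.
      move=> W; have [lt|lt|e] := ltngtP b b'; last by rewrite e eqxx in bb.
        exact: (W a b c a' b' c').
      by apply: (W a' b' c' a b c) => //; rewrite eq_sym.
    have := sqr_gap b b' lt.
    lia.
  subst b'; have e1 : (a + c = a' + c')%N by lia.
  have e2 : (a ^ 2 + c ^ 2 = a' ^ 2 + c' ^ 2)%N by lia.
  have aa : a = a'.
    have : ((a%:Z - a'%:Z) * (a%:Z - c'%:Z) = 0).
      have cE : c%:Z = a'%:Z + c'%:Z - a%:Z by lia.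
      have : a%:Z ^+ 2 + c%:Z ^+ 2 = a'%:Z ^+ 2 + c'%:Z ^+ 2.
        by rewrite !expr2 -!PoszM !mulnn -!PoszD e2.
      by rewrite cE; lia.
    move/eqP; rewrite mulf_eq0 => /orP[] /eqP; lia.
  by congr (_, _, _); lia.
move=> _ /mapP[k /rP/and5P[_ _ _ _ kI] ->]; by rewrite mem_iota.
Qed.

Lemma ex_pow2_between (a : nat) : (0 < a)%N -> exists s, (a <= 2 ^ s < 2 * a)%N.
Proof.
move=> a0; have ex : exists s, (a <= 2 ^ s)%N by exists a; apply: ltnW; exact: ltn_expl.
case: (ex_minnP ex) => s as_ smin; exists s; rewrite as_ /=.
case: s as_ smin => [|s] as_ smin; first by rewrite expn0; lia.
rewrite expnS ltn_pmul2l // ltnNge; apply/negP => /smin; by rewrite ltnn.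
Qed.

Lemma exp2_ge_quadratic (s : nat) : (20 <= s)%N -> (200 * s * s + 200 * s <= 2 ^ s)%N.
Proof.
elim: s => // k IH; rewrite leq_eqVlt => /orP[/eqP <-|]; first lia.
rewrite ltnS => k4; move: (IH k4); rewrite expnS; clear IH; move: (2 ^ k)%N => E; nia.
Qed.

Lemma norm3_ge0 (z : int * int) : 0 <= norm3 z.
Proof. by apply: addr_ge0; [exact: sqr_ge0 | apply: mulr_ge0 => //; exact: sqr_ge0]. Qed.

Lemma triple_count_near (R : realType) (g : nat) : (0 < g)%N ->
  exists C : nat, forall (nu mu s N2 A m H : nat) (r : seq (nat * nat * nat)),
  (2 ^ (g + 18) <= s)%N -> (5 * nu <= 2 ^ s < 10 * nu)%N -> (mu <= nu)%N ->
  (nu <= (nu - mu) * s)%N -> (N2 <= 2 * (2 ^ nu) ^ 2)%N -> (2 ^ 2 ^ (s - g) <= H)%N ->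
  uniq r -> (forall k, k \in r -> triple_window (2 ^ nu) N2 (2 ^ mu) A m H k) ->
  (size r <= C * H)%N.
Proof.
move=> g0; have [C CP] := lattice_count R g g0; exists (12 * C)%N.
move=> nu mu s N2 A m H r s0 /andP[nus1 nus2] munu gap N12 DH ur rP.
pose w := (nu - mu)%N.
have s20 : (2 ^ 18 <= s)%N.
  by apply: leq_trans s0; rewrite leq_exp2l // leq_addl.
have s_big : (200 * s * s + 200 * s <= 2 ^ s)%N.
  by apply: exp2_ge_quadratic; apply: leq_trans s20.
have s_pos : (0 < 80 * s)%N by lia.
have [t /andP[ts1 ts2]] := ex_pow2_between (80 * s) s_pos.
have [e eE] : exists e, e = ((w - 6) %/ 2)%N by eexists.
have tls : (t <= s)%N by rewrite -(@leq_exp2l 2) //; lia.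
pose V := (2 ^ (s - t))%N.
have VE : (V * 2 ^ t = 2 ^ s)%N by rewrite /V -expnD subnK.
have Vs : (8 * (s * V) <= nu)%N.
  by have : (80 * s * V <= 2 ^ t * V)%N by [rewrite leq_mul2r ts1 orbT|]; lia.
have we : (w <= 2 * e + 7)%N.
  by rewrite eE; have := divn_eq (w - 6) 2; have := ltn_pmod (w - 6) (isT : (0 < 2)%N); lia.
(* This is where the gap is used: w >= nu / s, whereas V <= nu / (8 s), so e, about w / 2, exceeds 2
   V with room for 4 s. The factor 80 in the choice of t provides the 8. *)
have Ve : (2 * V + 4 * s <= e)%N.
  rewrite leqNgt; apply/negP => lt.
  have : (nu <= s * (4 * V + 8 * s + 5))%N.
    by apply: leq_trans gap _; rewrite mulnC leq_mul2l; apply/orP; right; lia.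
  rewrite !mulnDr; lia.
have ew : (2 * e + 6 <= w)%N.
  by have := leq_trunc_div (w - 6) 2; rewrite -eE; lia.
have NE : (2 ^ nu = 2 ^ mu * 2 ^ w)%N by rewrite -expnD subnKC.
have N13 : (4 * 2 ^ mu <= 2 ^ nu)%N.
  by rewrite NE mulnC leq_mul2l; apply/orP; right; rewrite -[4%N]/(2 ^ 2)%N leq_exp2l //; lia.
have nu18 : (6 <= nu)%N by lia.
have key (r' : seq (nat * nat * nat)) : subseq r' r ->
    {in r' &, forall k l, 0 <= (triple_point k).2 * (triple_point l).2} ->
    (size r' <= C * (6 * H))%N.
  move=> r'r r'y.
  have r'P k : k \in r' -> triple_window (2 ^ nu) N2 (2 ^ mu) A m H k.
    by move=> /(mem_subseq r'r); exact: rP.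
  have r'A k : k \in r' -> triple_sum k = A by move/r'P => /and5P[_ _ _ /eqP].
  rewrite -(size_map triple_point).
  (* The window for n = 6 Q - 2 A^2 has length 6 H. If 6 m < 2 A^2, the truncated difference is 0
     and the window still contains every n. *)
  apply: (CP s t _ (6 * m - 2 * A ^ 2)%N (2 ^ e)%N) => //.
  - by rewrite ts1 /=; lia.
  - by apply: leq_trans DH _; rewrite leq_pmull.
  - by rewrite -/V -[4%N]/(2 ^ 2)%N -expnM -expnD leq_exp2l.
  - rewrite map_inj_in_uniq ?(subseq_uniq r'r) // => k l kr lr.
    by apply: triple_point_inj; rewrite !r'A.
  - move=> _ /mapP[[[k1 k2] k3] kr ->].
    have := r'P _ kr; rewrite /triple_window /dyadic_block /= => /and5P[].
    move=> /andP[a1 a2] /andP[b1 b2] /andP[c1 c2] /eqP kA /andP[Q1 Q2].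
    have k3N : (4 * k3 <= 2 ^ nu)%N by apply: leq_trans N13; rewrite leq_mul2l.
    have := triple_point_norm_ge (2 ^ nu) k1 k2 k3 a1 k3N.
    have nE := norm3_triple_point (k1, k2, k3); rewrite kA in nE.
    move: nE; set n := norm3 _; set Q := triple_sqr _ in Q1 Q2 *.
    move=> nE nN; have N0 : (0 < 2 ^ nu)%N by rewrite expn_gt0.
    have n0 : 0 < n by have : 0 < (2 ^ nu)%N%:Z ^+ 2 by [rewrite exprn_gt0|]; lia.
    exists `|n|%N; first by rewrite gtz0_abs.
    have nZ : `|n|%N%:Z = n by rewrite gtz0_abs.
    have A2 : A%:Z ^+ 2 = (A ^ 2)%N%:Z by rewrite expr2 -PoszM mulnn.
    apply/andP; split; last by rewrite A2 in nE; lia.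
    apply/andP; split; first by lia.
    apply: leq_trans (_ : 6 * Q <= _)%N; first by rewrite A2 in nE; lia.
    (* k2 <= N2 <= 2 N1^2 makes Q at most 6 N1^4, so n is below 2^(6 + 4 nu); hence the choice 2^s
       >= 5 nu. *)
    apply: leq_trans (_ : 36 * (2 ^ nu) ^ 4 <= _)%N.
      rewrite /Q /triple_sqr /=; set N := (2 ^ nu)%N in a2 N12 N0 k3N *.
      have q1 : (k1 ^ 2 <= N ^ 2)%N by rewrite leq_exp2r.
      have q2 : (k2 ^ 2 <= (2 * N ^ 2) ^ 2)%N by rewrite leq_exp2r // (leq_trans b2).
      have q3 : (k3 ^ 2 <= N ^ 2)%N by rewrite leq_exp2r // (leq_trans c2) // leq_exp2l.
      have q4 : (N ^ 2 <= N ^ 4)%N by rewrite leq_pexp2l.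
      have q5 : ((2 * N ^ 2) ^ 2 = 4 * N ^ 4)%N by rewrite expnMn -expnM.
      move: q1 q2 q3 q4; rewrite q5.
      move: (k1 ^ 2)%N (k2 ^ 2)%N (k3 ^ 2)%N (N ^ 2)%N (N ^ 4)%N; clear; lia.
    apply: leq_trans (_ : 2 ^ 6 * (2 ^ nu) ^ 4 <= _)%N; first by rewrite leq_mul2r orbT.
    by rewrite -expnM -expnD leq_exp2l //; lia.
  - move=> _ _ /mapP[[[k1 k2] k3] kr ->] /mapP[[[l1 l2] l3] lr ->] nn.
    have := r'P _ kr; rewrite /triple_window /dyadic_block /= => /and5P[].
    move=> /andP[a1 a2] /andP[b1 b2] /andP[c1 c2] /eqP kA _.
    have := r'P _ lr; rewrite /triple_window /dyadic_block /= => /and5P[].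
    move=> /andP[a1' a2'] /andP[b1' b2'] /andP[c1' c2'] /eqP lA _.
    have k3N : (4 * k3 <= 2 ^ nu)%N by apply: leq_trans N13; rewrite leq_mul2l.
    have nN := triple_point_norm_ge (2 ^ nu) k1 k2 k3 a1 k3N.
    have kn := esym (gez0_abs (norm3_ge0 (triple_point (k1, k2, k3)))).
    have ln : norm3 (triple_point (l1, l2, l3)) = `|norm3 (triple_point (k1, k2, k3))|%N.
      by rewrite -nn.
    rewrite kn in nN; move: (absz _) kn ln nN => n kn ln nN.
    have yy := r'y _ _ kr lr; move: kn ln yy; rewrite /triple_point /= => kn ln yy.
    apply: (det2_short_arc _ (2 ^ mu) w e _ _ _ _ kn ln yy _ _ ew).
    - by move: kA lA c2 c2'; rewrite /triple_sum /=; clear; lia.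
    - by rewrite -NE.
pose up (k : nat * nat * nat) := 0 <= (triple_point k).2.
have szr : (size r = size [seq k <- r | up k] + size [seq k <- r | ~~ up k])%N.
  by rewrite !size_filter -(count_predC up).
rewrite szr (_ : 12 * C * H = C * (6 * H) + C * (6 * H))%N; last by lia.
apply: leq_add; apply: key; rewrite ?filter_subseq //.
  by move=> k l; rewrite !mem_filter => /andP[k0 _] /andP[l0 _]; exact: mulr_ge0.
move=> k l; rewrite !mem_filter /up -!ltNge => /andP[k0 _] /andP[l0 _].
by apply: mulr_le0; exact: ltW.
Qed.

(* Finitely many values of nu are treated trivially; among them is nu = 1, where
   ln (ln 2) < 0 and the hypothesis allows 2^mu to exceed 2^nu, and nu = 0, where
   it relies on x / 0 = 0 and ln 0 = 0. *)
Lemma triple_count (R : realType) (alpha : R) : 0 < alpha -> exists C : nat,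
  forall (nu mu N2 A m H : nat) (r : seq (nat * nat * nat)),
  (2 ^ mu)%N%:R <= (2 ^ nu)%N%:R *
     expR (- ln (2 ^ nu)%N%:R / ln (ln (2 ^ nu)%N%:R)) :> R ->
  (0 < H)%N -> (2 ^ nu)%N%:R `^ alpha < H.+1%:R ->
  uniq r -> (forall k, k \in r -> triple_window (2 ^ nu) N2 (2 ^ mu) A m H k) ->
  (size r <= C * H)%N.
Proof.
(* With 2^g >= 10 / alpha and 2^s < 10 nu one has 2^(s-g) <= alpha nu, that is, D <= N1^alpha. *)
move=> alpha0; pose g := (Num.truncn (10 / alpha)).+1.
have g10 : 10 <= alpha * (2 ^ g)%N%:R.
  rewrite mulrC -ler_pdivrMr //; apply: le_trans (_ : g%:R <= _).
    by apply: ltW; exact: truncnS_gt.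
  by rewrite ler_nat ltnW // ltn_expl.
have [C1 C1P] := triple_count_near R g (isT : (0 < g)%N).
(* From nu0 on, 2^s >= 5 nu forces s >= 2^(g+18). Below it, [B nu] bounds N3, and [C0] adds up the
   finitely many trivial counts. *)
pose nu0 := (2 ^ 2 ^ (g + 18))%N.
pose B (nu : nat) : nat := Num.truncn ((2 ^ nu)%N%:R *
     expR (- ln (2 ^ nu)%N%:R / ln (ln (2 ^ nu)%N%:R)) : R).
pose C0 := (\sum_(nu < nu0) (2 ^ nu).+1 * (B nu).+1)%N.
exists (C0 + (C1 + 1))%N => nu mu N2 A m H r cond H0 NH ur rP.
have [small|big] := ltnP nu nu0.
  apply: leq_trans (triple_count_trivial _ _ _ _ _ _ _ ur rP) _.
  have mB : (2 ^ mu <= B nu)%N by rewrite truncn_ge_nat // (le_trans _ cond) // ler0n.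
  apply: leq_trans (_ : C0 <= _)%N; last first.
    by rewrite mulnDl; apply: leq_trans (leq_addr _ _); rewrite leq_pmulr.
  rewrite /C0 (bigD1 (Ordinal small)) //=; apply: leq_trans (leq_addr _ _).
  by rewrite leq_mul2l ltnS mB orbT.
have nu0_gt : (0 < nu0)%N by rewrite expn_gt0.
have nu5 : (0 < 5 * nu)%N by rewrite muln_gt0 /= (leq_trans nu0_gt).
have [s /andP[s1 s2]] := ex_pow2_between _ nu5.
have s0 : (2 ^ (g + 18) <= s)%N.
  by rewrite -(@leq_exp2l 2) //; apply: leq_trans big _; lia.
have s20 : (20 <= s)%N.
  by apply: leq_trans s0; apply: leq_trans (_ : 2 ^ 18 <= _)%N; rewrite // leq_exp2l // leq_addl.
have s200 := exp2_ge_quadratic s s20.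
have nu3 : (3 <= nu)%N by lia.
have nus : (nu <= 2 ^ s)%N by lia.
have [munu gap] := dyadic_gap R nu mu s nu3 cond nus.
have gs : (g <= s)%N.
  by apply: leq_trans s0; apply: leq_trans (ltnW (ltn_expl g (isT : 1 < 2)%N)) _; rewrite leq_exp2l // leq_addr.
have DH : (2 ^ 2 ^ (s - g) <= H)%N.
  rewrite -ltnS -(ltr_nat R); apply: le_lt_trans NH.
  have pE k : (2 ^ k)%N%:R = 2 `^ k%:R :> R by rewrite natrX powR_mulrn.
  rewrite (pE (2 ^ _)%N) (pE nu) -powRrM.
  apply: ler_powR; first by rewrite ler1n.
  have E : (2 ^ (s - g))%N%:R * (2 ^ g)%N%:R < 10 * nu%:R :> R.
    by rewrite -natrM -expnD subnK // -natrM ltr_nat; lia.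
  have P0 : 0 <= (2 ^ (s - g))%N%:R :> R by rewrite ler0n.
  have := ler_wpM2l P0 g10; rewrite mulrCA => h.
  have : alpha * ((2 ^ (s - g))%N%:R * (2 ^ g)%N%:R) < alpha * (10 * nu%:R).
    by rewrite ltr_pM2l.
  lra.
apply: leq_trans (_ : (C1 + 1) * H <= _)%N; last by rewrite leq_mul2r leq_addl orbT.
have [near|far] := leqP N2 (2 * (2 ^ nu) ^ 2).
  apply: leq_trans (_ : C1 * H <= _)%N; last by rewrite leq_mul2r leq_addr orbT.
  by apply: (C1P nu mu s N2 A m H r) => //; apply/andP; split => //; lia.
have w2 : (mu + 2 <= nu)%N.
  rewrite leqNgt; apply/negP => lt; have : ((nu - mu) * s <= 1 * s)%N.
    by rewrite leq_mul2r; apply/orP; right; lia.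
  lia.
apply: leq_trans (triple_count_far _ _ _ _ _ _ _ far _ ur rP) _; last by rewrite leq_pmull // addn1.
rewrite -expnS ltn_exp2l //; lia.
Qed.

(** * Fourier analysis on the circle *)

Definition sqnorm (R : realType) (z : R[i]) : R := complex.Re z ^+ 2 + complex.Im z ^+ 2.
Arguments sqnorm {R} z.

Lemma normc_sqr (R : realType) (z : R[i]) : ComplexField.Normc.normc z ^+ 2 = sqnorm z.
Proof. by case: z => a b; rewrite /sqnorm /= sqr_sqrtr // addr_ge0 ?sqr_ge0. Qed.

Lemma sqnorm_ge0 (R : realType) (z : R[i]) : 0 <= sqnorm z.
Proof. by rewrite addr_ge0 ?sqr_ge0. Qed.

Lemma sqnormM (R : realType) (z w : R[i]) : sqnorm (z * w) = sqnorm z * sqnorm w.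
Proof. by case: z w => [a b] [c d]; rewrite /sqnorm /=; ring. Qed.

Lemma sqnorm_conj (R : realType) (z : R[i]) : sqnorm z = complex.Re (z * conjc z).
Proof. by case: z => a b; rewrite /sqnorm /=; ring. Qed.

Lemma sqnormB (R : realType) (z w : R[i]) :
  sqnorm (z - w) = sqnorm z - 2 * complex.Re (z * conjc w) + sqnorm w.
Proof. by case: z w => [a b] [c d]; rewrite /sqnorm /=; ring. Qed.

Lemma cReD (R : realType) (z w : R[i]) : complex.Re (z + w) = complex.Re z + complex.Re w.
Proof. by case: z w => [a b] [c d]. Qed.

Lemma cImD (R : realType) (z w : R[i]) : complex.Im (z + w) = complex.Im z + complex.Im w.
Proof. by case: z w => [a b] [c d]. Qed.

Lemma cRe_sum (R : realType) (I : Type) (r : seq I) (P : pred I) (F : I -> R[i]) :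
  complex.Re (\sum_(i <- r | P i) F i) = \sum_(i <- r | P i) complex.Re (F i).
Proof. by apply: (big_morph _ (@cReD R)). Qed.

Lemma cIm_sum (R : realType) (I : Type) (r : seq I) (P : pred I) (F : I -> R[i]) :
  complex.Im (\sum_(i <- r | P i) F i) = \sum_(i <- r | P i) complex.Im (F i).
Proof. by apply: (big_morph _ (@cImD R)). Qed.

Lemma cReM (R : realType) (z w : R[i]) :
  complex.Re (z * w) = complex.Re z * complex.Re w - complex.Im z * complex.Im w.
Proof. by case: z w => [a b] [c d]. Qed.

Lemma cImM (R : realType) (z w : R[i]) :
  complex.Im (z * w) = complex.Re z * complex.Im w + complex.Im z * complex.Re w.
Proof. by case: z w => [a b] [c d]. Qed.

Lemma conjc_sum (R : realType) (I : Type) (r : seq I) (P : pred I) (F : I -> R[i]) :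
  conjc (\sum_(i <- r | P i) F i) = \sum_(i <- r | P i) conjc (F i).
Proof. exact: rmorph_sum. Qed.

Lemma conjcM (R : realType) (z w : R[i]) : conjc (z * w) = conjc z * conjc w.
Proof. exact: rmorphM. Qed.

(** Cauchy-Schwarz from the positive double sum of (G i - G j)^2, taken over the nonzero terms only.
    Counting only these is what lets the Fourier supports restrict the frequencies later. *)
Lemma sqnorm_sum_le (R : realType) (I : finType) (P : pred I) (M : nat) (F : I -> R[i]) :
  (#|[pred i | P i && (F i != 0%R)]| <= M)%N ->
  sqnorm (\sum_(i | P i) F i) <= M%:R * \sum_(i | P i) sqnorm (F i).
Proof.
move=> cM.
have CS (G : I -> R) : (forall i, P i -> F i = 0 -> G i = 0) ->
    (\sum_(i | P i) G i) ^+ 2 <= M%:R * \sum_(i | P i) G i ^+ 2.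
  move=> G0; pose Q := [pred i | P i && (F i != 0%R)].
  have QE (H : I -> R) : (forall i, P i -> F i = 0 -> H i = 0) ->
      \sum_(i | P i) H i = \sum_(i | Q i) H i.
    move=> H0; rewrite (bigID (fun i => F i != 0)) /= addrC big1 ?add0r // => i /andP[Pi].
    by rewrite negbK => /eqP; exact: H0.
  rewrite (QE G) // (QE (fun i => G i ^+ 2)); last by move=> i Pi Fi; rewrite G0 // expr0n.
  apply: le_trans (_ : #|Q|%:R * \sum_(i | Q i) G i ^+ 2 <= _); last first.
    by rewrite ler_wpM2r ?ler_nat // sumr_ge0 // => i _; exact: sqr_ge0.
  have : 0 <= \sum_(i | Q i) \sum_(j | Q j) (G i - G j) ^+ 2.
    by apply: sumr_ge0 => i _; apply: sumr_ge0 => j _; exact: sqr_ge0.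
  set S := \sum_(i | Q i) G i; set T := \sum_(i | Q i) G i ^+ 2.
  have -> : \sum_(i | Q i) \sum_(j | Q j) (G i - G j) ^+ 2 = 2 * (#|Q|%:R * T - S ^+ 2).
    rewrite (eq_bigr (fun i => #|Q|%:R * G i ^+ 2 - 2 * S * G i + T)); last first.
      move=> i _; rewrite (eq_bigr (fun j => G i ^+ 2 - 2 * G i * G j + G j ^+ 2)); last first.
        by move=> j _; ring.
      rewrite !big_split /= sumr_const sumrN -mulr_sumr -/S -/T -[G i ^+ 2 *+ _]mulr_natl.
      by ring.
    rewrite !big_split /= sumr_const sumrN -!mulr_sumr -/S -/T -[T *+ _]mulr_natl.
    by ring.
  lra.
rewrite /sqnorm cRe_sum cIm_sum big_split /= mulrDr; apply: lerD; apply: CS => i _ ->//.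
Qed.

Lemma cisD (R : realType) (s t : R) : cis (s + t) = cis s * cis t.
Proof. by rewrite /cis cosD sinD; apply/eqP; rewrite eq_complex /= !eqxx addrC eqxx. Qed.

Lemma cis0 (R : realType) : cis (0 : R) = 1.
Proof. by rewrite /cis cos0 sin0. Qed.

Lemma conjc_cis (R : realType) (t : R) : conjc (cis t) = cis (- t).
Proof. by rewrite /cis cosN sinN. Qed.

Section CircleIntegral.
Variable R : realType.
Notation mu := (@lebesgue_measure R).
Notation D := (circle R).

Lemma measurable_circle : measurable (D : set (measurableTypeR R)).
Proof. exact: measurable_itv. Qed.

Lemma pi2_gt0 : 0 < 2 * pi :> R.
Proof. by rewrite mulr_gt0 // pi_gt0. Qed.

Lemma measure_circle : mu D = (2 * pi)%:E.
Proof. by rewrite /circle lebesgue_measure_itv /= lte_fin pi2_gt0 sube0. Qed.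

Definition circle_integrable (f : R -> R) : Prop := mu.-integrable D (EFin \o f).

Definition circle_cintegrable (f : R -> R[i]) : Prop :=
  circle_integrable (fun x => complex.Re (f x)) /\
  circle_integrable (fun x => complex.Im (f x)).

Lemma circle_integrableD (f g : R -> R) : circle_integrable f -> circle_integrable g ->
  circle_integrable (fun x => f x + g x).
Proof. by move=> fi gi; exact: (integrableD measurable_circle fi gi). Qed.

Lemma circle_integrableZ (c : R) (f : R -> R) : circle_integrable f ->
  circle_integrable (fun x => c * f x).
Proof. by move=> fi; exact: (integrableZl measurable_circle c fi). Qed.

Lemma circle_integrable_le (f g : R -> R) : measurable_fun D f ->
  (forall x, `|f x| <= g x) -> circle_integrable g -> circle_integrable f.
Proof.
move=> mf fg gi; apply: (le_integrable measurable_circle _ _ gi).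
  exact/measurable_EFinP.
by move=> x _ /=; rewrite lee_fin (le_trans (fg x)) // ler_norm.
Qed.

Lemma circle_integrable_cst (c : R) : circle_integrable (fun=> c).
Proof.
apply: measurable_bounded_integrable.
- exact: measurable_circle.
- by have /= := measure_circle; move=> ->; rewrite ltry.
- exact: measurable_cst.
- by exists `|c|; split; [exact: num_real | move=> y cy x _ /=; exact: ltW].
Qed.

Lemma circle_cintegrableD (f g : R -> R[i]) : circle_cintegrable f ->
  circle_cintegrable g -> circle_cintegrable (fun x => f x + g x).
Proof.
move=> [f1 f2] [g1 g2]; split.
  by under eq_fun do rewrite cReD; exact: circle_integrableD.
by under eq_fun do rewrite cImD; exact: circle_integrableD.
Qed.

Lemma cintegralD (f g : R -> R[i]) : circle_cintegrable f -> circle_cintegrable g ->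
  cintegral D (fun x => f x + g x) = cintegral D f + cintegral D g.
Proof.
move=> [f1 f2] [g1 g2]; rewrite /cintegral.
under eq_Rintegral do rewrite cReD; under [X in (_ +i* X)%C]eq_Rintegral do rewrite cImD.
by rewrite !RintegralD //; exact: measurable_circle.
Qed.

Lemma circle_cintegrableZ (c : R[i]) (f : R -> R[i]) : circle_cintegrable f ->
  circle_cintegrable (fun x => c * f x).
Proof.
move=> [f1 f2]; split.
  under eq_fun do rewrite cReM -mulNr.
  by apply: circle_integrableD; apply: circle_integrableZ.
under eq_fun do rewrite cImM.
by apply: circle_integrableD; apply: circle_integrableZ.
Qed.

Lemma cintegralZ (c : R[i]) (f : R -> R[i]) : circle_cintegrable f ->
  cintegral D (fun x => c * f x) = c * cintegral D f.
Proof.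
move=> [f1 f2]; rewrite /cintegral.
under eq_Rintegral do rewrite cReM -mulNr; under [X in (_ +i* X)%C]eq_Rintegral do rewrite cImM.
have mD := measurable_circle.
rewrite !RintegralD //; try by apply: circle_integrableZ.
rewrite !RintegralZl //; case: c => a b /=.
by apply/eqP; rewrite eq_complex /= mulNr !eqxx.
Qed.

Lemma circle_cintegrable_sum (I : Type) (r : seq I) (P : pred I) (F : I -> R -> R[i]) :
  (forall i, P i -> circle_cintegrable (F i)) ->
  circle_cintegrable (fun x => \sum_(i <- r | P i) F i x).
Proof.
move=> Fi; elim: r => [|i r IH].
  under eq_fun do rewrite big_nil.
  by split; exact: circle_integrable_cst.
under eq_fun do rewrite big_cons.
by have [Pi|//] := boolP (P i); apply: circle_cintegrableD => //; exact: Fi.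
Qed.

Lemma cintegral_sum (I : Type) (r : seq I) (P : pred I) (F : I -> R -> R[i]) :
  (forall i, P i -> circle_cintegrable (F i)) ->
  cintegral D (fun x => \sum_(i <- r | P i) F i x) = \sum_(i <- r | P i) cintegral D (F i).
Proof.
move=> Fi; elim: r => [|i r IH].
  under eq_fun do rewrite big_nil.
  by rewrite big_nil /cintegral !Rintegral_cst ?mul0r //; exact: measurable_circle.
under eq_fun do rewrite big_cons; rewrite big_cons -IH.
have [Pi|//] := boolP (P i); rewrite cintegralD //; first exact: Fi.
exact: circle_cintegrable_sum.
Qed.

Lemma continuous_cos_lin (k s : R) : continuous (fun x : R => cos (x * k + s)).
Proof.
move=> x; apply: (continuous_comp (f := fun x : R => x * k + s)); last exact: continuous_cos.
by apply: cvgD; [apply: cvgMl; exact: cvg_id | exact: cvg_cst].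
Qed.

Lemma continuous_sin_lin (k s : R) : continuous (fun x : R => sin (x * k + s)).
Proof.
move=> x; apply: (continuous_comp (f := fun x : R => x * k + s)); last exact: continuous_sin.
by apply: cvgD; [apply: cvgMl; exact: cvg_id | exact: cvg_cst].
Qed.

Lemma circle_cintegrable_cis (k : R) : circle_cintegrable (fun x => cis (x * k)).
Proof.
split.
  apply: circle_integrable_le (circle_integrable_cst 1) => [|x]; last exact: cos_max.
  have : measurable_fun setT (fun x : R => cos (x * k + 0)).
    exact: continuous_measurable_fun (continuous_cos_lin k 0).
  by under eq_fun do rewrite addr0; exact: measurable_funS.
apply: circle_integrable_le (circle_integrable_cst 1) => [|x]; last exact: sin_max.
have : measurable_fun setT (fun x : R => sin (x * k + 0)).
  exact: continuous_measurable_fun (continuous_sin_lin k 0).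
by under eq_fun do rewrite addr0; exact: measurable_funS.
Qed.

End CircleIntegral.

Section Parseval.
Variable R : realType.
Notation mu := (@lebesgue_measure R).
Notation D := (circle R).

Lemma Rintegral_circle_FTC (f F : R -> R) : continuous f ->
  (forall x : R, is_derive x (1 : R) F (f x)) ->
  \int[mu]_(x in D) f x = F (2 * pi) - F 0.
Proof.
move=> cf dF; have pi0 := pi2_gt0 R.
have cF : continuous F.
  by move=> x; apply/differentiable_continuous/derivable1_diffP; have [] := dF x.
have ci : mu.-integrable `[0, 2 * pi] (EFin \o f).
  by apply: continuous_compact_integrable; [exact: segment_compact | exact: continuous_subspaceT].
rewrite /circle Rintegral_itv_bndo_bndc; last first.
  by apply: integrableS ci => //; exact: subset_itv_co_cc.
rewrite /Rintegral (@continuous_FTC2 _ f F) //=.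
- exact: continuous_subspaceT.
- split.
  + by move=> x _; have [] := dF x.
  + by apply: cvg_at_right_filter; exact: cF.
  + by apply: cvg_at_left_filter; exact: cF.
- by move=> x _; rewrite derive1E; have := dF x => h; exact: derive_val.
Qed.

Lemma cis_2pi (k : int) : cis (2 * pi * k%:~R : R) = 1.
Proof.
have base : cis (2 * pi : R) = 1.
  by rewrite /cis mulrC mulr_natr cos2pi sin2pi.
have pow n : cis (2 * pi * n%:R : R) = 1.
  elim: n => [|n IH]; first by rewrite mulr0 cis0.
  by rewrite -[n.+1]addn1 natrD mulrDr mulr1 cisD IH base mulr1.
case: (intP k) => [|n|n]; first by rewrite mulr0 cis0.
  exact: pow.
rewrite mulrNz mulrN -conjc_cis (pow n.+1).
by apply/eqP; rewrite eq_complex /= oppr0 !eqxx.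
Qed.

Lemma cintegral_cis (k : int) :
  cintegral D (fun x => cis (x * k%:~R)) = (if k == 0 then 2 * pi else 0)%:C%C :> R[i].
Proof.
have [->|k0] := eqVneq k 0.
  rewrite /cintegral; under eq_Rintegral do rewrite mulr0 /= cos0.
  under [X in (_ +i* X)%C]eq_Rintegral do rewrite mulr0 /= sin0.
  have mD := measurable_circle R.
  rewrite !Rintegral_cst // mul0r mul1r; congr (_ +i* _)%C.
  by rewrite -[LHS]/(fine (mu D)) measure_circle.
have kr : k%:~R != 0 :> R by rewrite intr_eq0.
have := cis_2pi k; rewrite /cis => -[c2 s2].
rewrite /cintegral /=.
have lin (c x : R) : is_derive x (1 : R) (fun y => y * c) c.
  by apply: is_derive_eq; rewrite /GRing.scale /= ?mul1r ?mulr1 ?mulr0 ?add0r ?addr0.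
have dsin (x : R) : is_derive x (1 : R) (fun y => sin (y * k%:~R) * (k%:~R)^-1) (cos (x * k%:~R)).
  have h := @is_derive1_comp R sin (fun y => y * k%:~R) x _ _ (is_derive_sin (x * k%:~R)) (lin _ x).
  have h2 := @is_derive1_comp R (fun y => y * (k%:~R)^-1) (sin \o (fun y => y * k%:~R)) x _ _ (lin _ _) h.
  by apply: (is_derive_eq h2); rewrite mulrCA mulVf ?mulr1.
have dcos (x : R) : is_derive x (1 : R) (fun y => cos (y * k%:~R) * - (k%:~R)^-1) (sin (x * k%:~R)).
  have h := @is_derive1_comp R cos (fun y => y * k%:~R) x _ _ (is_derive_cos (x * k%:~R)) (lin _ x).
  have h2 := @is_derive1_comp R (fun y => y * - (k%:~R)^-1) (cos \o (fun y => y * k%:~R)) x _ _ (lin _ _) h.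
  by apply: (is_derive_eq h2); rewrite mulNr mulNr mulrN opprK mulrCA mulVf ?mulr1.
have ccos : continuous (fun x : R => cos (x * k%:~R)).
  by have := continuous_cos_lin R k%:~R 0; under eq_fun do rewrite addr0.
have csin : continuous (fun x : R => sin (x * k%:~R)).
  by have := continuous_sin_lin R k%:~R 0; under eq_fun do rewrite addr0.
rewrite (Rintegral_circle_FTC _ _ ccos dsin) (Rintegral_circle_FTC _ _ csin dcos).
by rewrite s2 c2 !mul0r cos0 sin0 mul0r !subrr.
Qed.


Lemma sqnorm_sum_cis (I : finType) (c : I -> R[i]) (p : I -> int) (x : R) :
  sqnorm (\sum_i c i * cis (x * (p i)%:~R)) =
  complex.Re (\sum_i \sum_j c i * conjc (c j) * cis (x * (p i - p j)%:~R)).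
Proof.
rewrite sqnorm_conj conjc_sum mulr_suml; congr complex.Re; apply: eq_bigr => i _.
rewrite mulr_sumr; apply: eq_bigr => j _.
rewrite conjcM conjc_cis intrB mulrBr cisD; ring.
Qed.

Lemma circle_cintegrable_double_sum (I : finType) (c : I -> R[i]) (p : I -> int) :
  circle_cintegrable R
    (fun x => \sum_i \sum_j c i * conjc (c j) * cis (x * (p i - p j)%:~R)).
Proof.
apply: circle_cintegrable_sum => i _; apply: circle_cintegrable_sum => j _.
by apply: circle_cintegrableZ; exact: circle_cintegrable_cis.
Qed.

Lemma circle_integrable_sqnorm_sum (I : finType) (c : I -> R[i]) (p : I -> int) :
  circle_integrable R (fun x => sqnorm (\sum_i c i * cis (x * (p i)%:~R))).
Proof.
under eq_fun do rewrite sqnorm_sum_cis.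
by have [] := circle_cintegrable_double_sum I c p.
Qed.

Lemma parseval_circle (I : finType) (c : I -> R[i]) (p : I -> int) : injective p ->
  \int[mu]_(x in D) sqnorm (\sum_i c i * cis (x * (p i)%:~R)) =
  2 * pi * \sum_i sqnorm (c i).
Proof.
move=> pI; under eq_Rintegral do rewrite sqnorm_sum_cis.
rewrite -[LHS]/(complex.Re (cintegral D _)).
rewrite cintegral_sum; last first.
  move=> i _; apply: circle_cintegrable_sum => j _.
  by apply: circle_cintegrableZ; exact: circle_cintegrable_cis.
rewrite cRe_sum mulr_sumr; apply: eq_bigr => i _.
rewrite cintegral_sum; last first.
  by move=> j _; apply: circle_cintegrableZ; exact: circle_cintegrable_cis.
rewrite (bigD1 i) //= big1 ?addr0 => [|j ji]; last first.
  rewrite cintegralZ; last exact: circle_cintegrable_cis.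
  by rewrite cintegral_cis subr_eq0 (inj_eq pI) eq_sym (negPf ji) mulr0.
rewrite cintegralZ; last exact: circle_cintegrable_cis.
rewrite cintegral_cis subrr eqxx sqnorm_conj; move: (c i * conjc (c i)) => [a b] /=; ring.
Qed.

End Parseval.

Section Bessel.
Variables (R : realType) (f : R -> R[i]).
Hypothesis fL2 : L2_circle f.
Notation mu := (@lebesgue_measure R).
Notation D := (circle R).

Lemma circle_integrable_sqnorm : circle_integrable R (fun x => sqnorm (f x)).
Proof.
have [_ mRe mIm f2] := fL2; apply/integrableP; split.
  apply/measurable_EFinP; apply: (@measurable_funS _ _ _ _ setT) => //.
  by apply: measurable_funD; apply: measurable_funX.
under eq_integral do rewrite /= ger0_norm ?sqnorm_ge0 // -normc_sqr.
by move: f2; rewrite /L2norm; apply: lty_poweRy; rewrite invr_eq0.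
Qed.

Lemma L2norm_sqr : (L2norm f ^+ 2 = (\int[mu]_(x in D) sqnorm (f x))%:E)%E.
Proof.
have fin := integrable_fin_num (measurable_circle R) circle_integrable_sqnorm.
have i0 : (0 <= \int[mu]_(x in D) (sqnorm (f x))%:E)%E.
  by apply: integral_ge0 => x _; rewrite lee_fin sqnorm_ge0.
rewrite /L2norm; under eq_integral do rewrite normc_sqr.
rewrite /Rintegral; move: fin i0; rewrite -[X in X \is a _]/(\int[mu]_(x in D) (sqnorm (f x))%:E)%E.
case: (integral _ _ _) => // r _; rewrite lee_fin => r0 /=.
by rewrite -EFinM powR12_sqrt // -expr2 sqr_sqrtr.
Qed.

Lemma circle_cintegrable_fourier (k : int) :
  circle_cintegrable R (fun x => cis (- (x * k%:~R)) * f x).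
Proof.
have [_ mRe mIm _] := fL2.
(* L^2 is contained in L^1 on the circle, through |u| + |v| <= 1 + u^2 + v^2. *)
have dom : circle_integrable R (fun x => 1 + sqnorm (f x)).
  by apply: circle_integrableD; [exact: circle_integrable_cst | exact: circle_integrable_sqnorm].
have mcos : measurable_fun setT (fun x : R => cos (- (x * k%:~R))).
  have := continuous_measurable_fun (continuous_cos_lin R (- k%:~R) 0).
  by under eq_fun do rewrite addr0 mulrN.
have msin : measurable_fun setT (fun x : R => sin (- (x * k%:~R))).
  have := continuous_measurable_fun (continuous_sin_lin R (- k%:~R) 0).
  by under eq_fun do rewrite addr0 mulrN.
have bound (a b u v : R) : `|a| <= 1 -> `|b| <= 1 ->
    `|a * u - b * v| <= 1 + (u ^+ 2 + v ^+ 2) /\ `|a * v + b * u| <= 1 + (u ^+ 2 + v ^+ 2).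
  move=> a1 b1.
  have key (y z : R) : `|y| + `|z| <= 1 + (y ^+ 2 + z ^+ 2).
    have := sqr_ge0 (`|y| - 2^-1); have := sqr_ge0 (`|z| - 2^-1).
    rewrite -[in X in _ -> _ -> X](real_normK (num_real y)) -[in X in _ -> _ -> X](real_normK (num_real z)); lra.
  have m (y z : R) : `|y| <= 1 -> `|y * z| <= `|z| by move=> y1; rewrite normrM ler_piMl.
  split.
    apply: le_trans (ler_normB _ _) _; apply: le_trans (key u v).
    by apply: lerD; apply: m.
  apply: le_trans (ler_normD _ _) _; rewrite addrC; apply: le_trans (key u v).
  by apply: lerD; apply: m.
split; (apply: circle_integrable_le dom => [|x]).
- under eq_fun do rewrite cReM.
  apply: (@measurable_funS _ _ _ _ setT) => //.
  by apply: measurable_funB; apply: measurable_funM.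
- by rewrite cReM; case: (bound _ _ (complex.Re (f x)) (complex.Im (f x)) (cos_max (- (x * k%:~R))) (sin_max (- (x * k%:~R)))).
- under eq_fun do rewrite cImM.
  apply: (@measurable_funS _ _ _ _ setT) => //.
  by apply: measurable_funD; apply: measurable_funM.
- by rewrite cImM; case: (bound _ _ (complex.Re (f x)) (complex.Im (f x)) (cos_max (- (x * k%:~R))) (sin_max (- (x * k%:~R)))).
Qed.

(** Expand the integral of |f - P|^2 >= 0 for the Fourier sum P over the frequencies 0 <= k < n.
    [fourier] carries no factor 1 / (2 pi), hence the 2 pi on the right. *)
Lemma bessel (n : nat) :
  \sum_(k < n) sqnorm (fourier f k%:Z) <= 2 * pi * \int[mu]_(x in D) sqnorm (f x).
Proof.
pose d (k : 'I_n) : R[i] := ((2 * pi)^-1)%:C%C * fourier f k%:Z.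
pose P (x : R) := \sum_k d k * cis (x * (k%:Z)%:~R).
have pI : injective (fun k : 'I_n => k%:Z) by move=> a b [] /val_inj.
have pi0 := pi2_gt0 R.
have conjP x : f x * conjc (P x) = \sum_k conjc (d k) * (cis (- (x * (k%:Z)%:~R)) * f x).
  rewrite conjc_sum mulr_sumr; apply: eq_bigr => k _.
  by rewrite conjcM conjc_cis mulrC mulrA.
have iP : circle_cintegrable R (fun x => f x * conjc (P x)).
  under eq_fun do rewrite conjP.
  by apply: circle_cintegrable_sum => k _; apply: circle_cintegrableZ; exact: circle_cintegrable_fourier.
have : 0 <= \int[mu]_(x in D) sqnorm (f x - P x).
  by apply: Rintegral_ge0 => x _; exact: sqnorm_ge0.
under eq_Rintegral do rewrite sqnormB -mulNr.
have i1 := circle_integrable_sqnorm; have i2 := circle_integrable_sqnorm_sum R _ d (fun k : 'I_n => k%:Z).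
have i3 : circle_integrable R (fun x => - 2 * complex.Re (f x * conjc (P x))).
  by apply: circle_integrableZ; have [] := iP.
have mD := measurable_circle R.
rewrite RintegralD //; last exact: circle_integrableD.
rewrite RintegralD // RintegralZl //; last by have [] := iP.
rewrite parseval_circle // -[X in - 2 * X]/(complex.Re (cintegral D (fun x => f x * conjc (P x)))).
have -> : cintegral D (fun x => f x * conjc (P x)) = \sum_k conjc (d k) * fourier f k%:Z.
  under eq_fun do rewrite conjP; rewrite cintegral_sum; last first.
    by move=> k _; apply: circle_cintegrableZ; exact: circle_cintegrable_fourier.
  by apply: eq_bigr => k _; rewrite cintegralZ //; exact: circle_cintegrable_fourier.
have e1 : complex.Re (\sum_k conjc (d k) * fourier f k%:Z) =
    (2 * pi)^-1 * \sum_(k < n) sqnorm (fourier f k%:Z).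
  rewrite cRe_sum mulr_sumr; apply: eq_bigr => k _; rewrite /d /sqnorm.
  by case: (fourier f k%:Z) => a b /=; ring.
have e2 : \sum_k sqnorm (d k) = (2 * pi)^-1 ^+ 2 * \sum_(k < n) sqnorm (fourier f k%:Z).
  rewrite mulr_sumr; apply: eq_bigr => k _; rewrite /d sqnormM.
  by congr (_ * _); rewrite /sqnorm /= expr0n addr0.
rewrite e1 e2; set S := \sum_(k < n) _; set E := Rintegral _ _ _.
have -> : 2 * pi * ((2 * pi)^-1 ^+ 2 * S) = (2 * pi)^-1 * S by rewrite mulrA expr2 (mulrA (2 * pi)) mulfV ?gt_eqF // mul1r.
move=> h; rewrite -ler_pdivrMl //; lra.
Qed.
End Bessel.

(** * Reduction of the space-time integral to counting *)

Section Strichartz.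
Variable R : realType.
Notation mu := (@lebesgue_measure R).
Notation D := (circle R).

(** The space is arbitrary because this is applied both to functions of t and to functions of (t,
    x). *)
Lemma measurable_sqnorm_sum d (T : measurableType d) (I : finType) (c : I -> R[i])
    (th : I -> T -> R) : (forall i, measurable_fun setT (th i)) ->
  measurable_fun setT (fun p => sqnorm (\sum_i c i * cis (th i p))).
Proof.
move=> mth.
have mcos i : measurable_fun setT (fun p => cos (th i p)).
  exact: (measurableT_comp (continuous_measurable_fun (@continuous_cos R)) (mth i)).
have msin i : measurable_fun setT (fun p => sin (th i p)).
  exact: (measurableT_comp (continuous_measurable_fun (@continuous_sin R)) (mth i)).
apply: measurable_funD; apply: measurable_funX.
  under eq_fun do (rewrite cRe_sum; under eq_bigr do rewrite cReM).
  apply: measurable_sum => i; apply: measurable_funB; apply: measurable_funM;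
    by [exact: measurable_cst | exact: mcos | exact: msin].
under eq_fun do (rewrite cIm_sum; under eq_bigr do rewrite cImM).
apply: measurable_sum => i; apply: measurable_funD; apply: measurable_funM;
  by [exact: measurable_cst | exact: mcos | exact: msin].
Qed.

(** All phases t h lie in [0, 1], so every term has real part at least cos 1 > 0 and nothing
    cancels. *)
Lemma dirichlet_ge (H : nat) (t : R) : 0 <= t -> t * H%:R <= 1 ->
  (cos 1 * H%:R) ^+ 2 <= sqnorm (\sum_(h < H) cis (- (t * h%:R))).
Proof.
move=> t0 tH; have c1 := @cos1_gt0 R.
apply: le_trans (_ : complex.Re (\sum_(h < H) cis (- (t * h%:R))) ^+ 2 <= _); last first.
  by rewrite /sqnorm lerDl sqr_ge0.
rewrite ler_sqr ?nnegrE ?mulr_ge0 ?ler0n ?(ltW c1) //.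
  rewrite cRe_sum; apply: le_trans (_ : \sum_(h < H) cos 1 <= _).
    by rewrite sumr_const card_ord mulr_natr.
  apply: ler_sum => h _ /=; rewrite cosN.
  have th0 : 0 <= t * h%:R by rewrite mulr_ge0.
  have th1 : t * h%:R <= 1.
    by apply: le_trans tH; rewrite ler_wpM2l // ler_nat ltnW.
  have pi2 := @pi_ge2 R.
  have i1 : (1 : R) \in `[0, pi] by rewrite in_itv /= ler01; lra.
  have ih : t * h%:R \in `[0, pi] by rewrite in_itv /= th0; lra.
  by rewrite leNgt ltr_cos // -leNgt.
rewrite cRe_sum; apply: sumr_ge0 => h _ /=; rewrite cosN.
apply: cos_ge0_pihalf; have := @pihalf_ge1 R.
have th0 : 0 <= t * h%:R by rewrite mulr_ge0.
have th1 : t * h%:R <= 1.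
  by apply: le_trans tH; rewrite ler_wpM2l // ler_nat ltnW.
by move: (pi / 2) => q q1; apply/andP; split; lra.
Qed.

Lemma integral_circle_sqnorm_sum (I : finType) (c : I -> R[i]) (p : I -> int) :
  injective p ->
  (\int[mu]_(x in D) (sqnorm (\sum_i c i * cis (x * (p i)%:~R)))%:E)%E =
  (2 * pi * \sum_i sqnorm (c i))%:E.
Proof.
move=> pI; rewrite -(parseval_circle R I c p pI) /Rintegral fineK //.
exact: (integrable_fin_num (measurable_circle R) (circle_integrable_sqnorm_sum R I c p)).
Qed.

Lemma tonelli_rectangle (T : R) (f : R * R -> R) :
  measurable_fun (setT : set (measurableTypeR R * measurableTypeR R)) f ->
  (forall p, 0 <= f p) ->
  (\int[mu \x mu]_(p in `[0%R, T] `*` D) (f p)%:E =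
   \int[mu]_(t in `[0%R, T]) \int[mu]_(x in D) (f (t, x))%:E)%E.
Proof.
move=> mf f0.
have mT : measurable (`[0, T] : set (measurableTypeR R)) by exact: measurable_itv.
have mR : measurable (`[0, T] `*` D : set (measurableTypeR R * measurableTypeR R)).
  by apply: measurableX => //; exact: measurable_circle.
rewrite integral_mkcond fubini_tonelli1; last 2 first.
- apply/(measurable_restrictT _ mR); apply/measurable_EFinP.
  exact: measurable_funS mf.
- by move=> p; rewrite /patch; case: ifP => // _; rewrite lee_fin.
rewrite [RHS]integral_mkcond; apply: eq_integral => t _.
rewrite /fubini_F /patch; case: ifPn => tT; last first.
  apply: integral0_eq => x _; rewrite ifF //; apply/negP => /set_mem[/= t' _].
  by move/negP: tT; apply; apply/mem_set.
rewrite [RHS]integral_mkcond; apply: eq_integral => x _; rewrite /patch.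
congr (if _ then _ else _); apply/idP/idP => /set_mem.
  by case=> /= _ xD; apply/mem_set.
by move=> xD; apply/mem_set; split => //=; apply/set_mem.
Qed.

End Strichartz.

Section LocalStrichartz.
Variables (R : realType) (I : finType) (c : I -> R[i]) (A Q : I -> nat) (H M : nat).
Hypothesis H0 : (0 < H)%N.
Hypothesis count_le : forall a m : nat,
  (#|[pred i | [&& c i != 0%R, A i == a & (m <= Q i < m + H)%N]]| <= M)%N.
Notation mu := (@lebesgue_measure R).
Notation D := (circle R).

Let B := (\max_i A i).+1.
Let L := ((\max_i Q i) + H)%N.

Let A_lt i : (A i < B)%N.
Proof. by rewrite ltnS (leq_bigmax i). Qed.

Let g (t : R) (a : 'I_B) : R[i] := \sum_(i | A i == a) c i * cis (- (t * (Q i)%:R)).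

(** The coefficient at frequency - m in t of [g t a] times the Dirichlet kernel. It collects the
    indices with Q in (m - H, m], a window to which [count_le] applies. *)
Let e (a : 'I_B) (m : 'I_L) : R[i] :=
  \sum_(q : I * 'I_H | (A q.1 == a) && (Q q.1 + q.2 == m)%N) c q.1.

Let wave_sum (t x : R) :
  \sum_i c i * cis ((A i)%:R * x - t * (Q i)%:R) = \sum_a g t a * cis (x * (a%:Z)%:~R).
Proof.
rewrite (partition_big (fun i => Ordinal (A_lt i)) predT) //=; apply: eq_bigr => a _.
rewrite /g mulr_suml; apply: eq_big => [i|i /eqP <-]; first by rewrite -val_eqE.
by rewrite -mulrA -cisD /=; congr (_ * cis _); rewrite [RHS]addrC mulrC.
Qed.

Let kernel_sum (t : R) (a : 'I_B) :
  g t a * (\sum_(h < H) cis (- (t * h%:R))) = \sum_m e a m * cis (t * (- m%:Z)%:~R).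
Proof.
rewrite /g mulr_suml; under eq_bigr do rewrite mulr_sumr.
rewrite pair_big /=.
have QL (q : I * 'I_H) : (Q q.1 + q.2 < L)%N.
  by rewrite /L -addnS leq_add // (leq_bigmax q.1).
rewrite (partition_big (fun q => Ordinal (QL q)) predT) //=; apply: eq_bigr => m _.
rewrite /e mulr_suml; apply: eq_big => [q|q /andP[_ /eqP <-]].
  by rewrite andbT -val_eqE.
rewrite -mulrA -cisD /=; congr (_ * cis _).
by rewrite mulrNz mulrN -pmulrn natrD mulrDr opprD.
Qed.

(** Each coefficient has at most M nonzero terms, whence M by Cauchy-Schwarz. Each pair (i, h)
    belongs to at most one (a, m), so c i is counted at most H times. *)
Let coeff_sum : \sum_a \sum_m sqnorm (e a m) <= (M * H)%N%:R * \sum_i sqnorm (c i).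
Proof.
apply: le_trans (_ : \sum_(a < B) \sum_(m < L) M%:R *
    \sum_(q : I * 'I_H | (A q.1 == a) && (Q q.1 + q.2 == m)%N) sqnorm (c q.1) <= _).
  apply: ler_sum => a _; apply: ler_sum => m _; apply: sqnorm_sum_le.
  apply: leq_trans (count_le a (m.+1 - H)%N).
  rewrite -(card_in_image (f := fun q : I * 'I_H => q.1)); last first.
    move=> [i h] [j h']; rewrite !inE /= => /andP[/andP[_ /eqP E1] _] /andP[/andP[_ /eqP E2] _] ij.
    by subst j; congr (_, _); apply: val_inj => /=; lia.
  apply: subset_leq_card; apply/fintype.subsetP => _ /mapP[[i h] + ->].
  rewrite mem_enum !inE /= => /andP[/andP[/eqP -> /eqP E] ->]; rewrite eqxx /=.
  by have := ltn_ord h; lia.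
rewrite natrM -mulrA.
under eq_bigr do rewrite -mulr_sumr.
rewrite -mulr_sumr ler_wpM2l ?ler0n //.
rewrite pair_big /= (exchange_big_dep predT) //=.
apply: le_trans (_ : \sum_(q : I * 'I_H) sqnorm (c q.1) <= _).
  apply: ler_sum => q _; rewrite sumr_const -[leLHS]mulr_natl ler_piMl ?sqnorm_ge0 //.
  rewrite -[leRHS]/(1%:R) ler_nat; apply/card_le1_eqP => -[a m] [a' m'].
  rewrite !unfold_in /= => /andP[/eqP E1 /eqP E2] /andP[/eqP E3 /eqP E4].
  by congr (_, _); apply: val_inj; rewrite /= -?E1 -?E3 -?E2 -?E4.
rewrite -(pair_big predT predT (fun i _ => sqnorm (c i))) /=.
under eq_bigr do rewrite sumr_const card_ord -mulr_natl.
by rewrite mulr_sumr.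
Qed.

(** The constant collects 2 pi from Parseval in x, 2 pi from Parseval in t, (cos 1 H)^(-2) from the
    kernel and M H from [coeff_sum]. *)
Lemma local_strichartz (T : R) : 0 <= T -> T * H%:R <= 1 ->
  (\int[mu \x mu]_(p in `[0%R, T] `*` D)
     (sqnorm (\sum_i c i * cis ((A i)%:R * p.2 - p.1 * (Q i)%:R)))%:E <=
   ((2 * pi / cos 1) ^+ 2 * (M%:R / H%:R) * \sum_i sqnorm (c i))%:E)%E.
Proof.
move=> T0 TH; have c1 := @cos1_gt0 R; have pi0 := pi2_gt0 R.
have Hr : 0 < H%:R :> R by rewrite ltr0n.
pose k := cos 1 * H%:R : R.
have k0 : 0 < k by rewrite mulr_gt0.
pose W (t : R) := \sum_a sqnorm (g t a).
pose V (t : R) := \sum_a sqnorm (\sum_m e a m * cis (t * (- m%:Z)%:~R)).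
have mth (u : I -> R) : forall i, measurable_fun (setT : set (measurableTypeR R)) (fun t : R => - (t * u i)).
  by move=> i; apply: measurableT_comp => //; apply: measurable_funM.
have W0 t : 0 <= W t by apply: sumr_ge0 => a _; exact: sqnorm_ge0.
have V0 t : 0 <= V t by apply: sumr_ge0 => a _; exact: sqnorm_ge0.
have WV t : t \in `[0, T] -> W t <= (k ^+ 2)^-1 * V t.
  rewrite in_itv /= => /andP[t0 tT]; rewrite ler_pdivlMl ?exprn_gt0 // /W /V mulr_sumr.
  apply: ler_sum => a _; rewrite -kernel_sum sqnormM mulrC ler_wpM2l ?sqnorm_ge0 //.
  by apply: dirichlet_ge => //; apply: le_trans TH; rewrite ler_wpM2r // ltW.
have mW : measurable_fun (setT : set (measurableTypeR R)) W.
  apply: measurable_sum => a; rewrite /g; under eq_fun do rewrite big_mkcond /=.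
  have -> : (fun t : R => sqnorm (\sum_i (if A i == a then c i * cis (- (t * (Q i)%:R)) else 0))) =
      (fun t => sqnorm (\sum_i (if A i == a then c i else 0) * cis (- (t * (Q i)%:R)))).
    by apply/funext => t; congr sqnorm; apply: eq_bigr => i _; case: ifP; rewrite ?mul0r.
  exact: (measurable_sqnorm_sum R _ _ _ _ (fun (i : I) (t : R) => - (t * (Q i)%:R)) (mth _)).
have mV : measurable_fun (setT : set (measurableTypeR R)) V.
  apply: measurable_sum => a.
  apply: (measurable_sqnorm_sum R _ _ _ _ (fun (m : 'I_L) (t : R) => t * (- (nat_of_ord m)%:Z)%:~R)) => m.
  exact: measurable_funM.
have mF : measurable_fun (setT : set (measurableTypeR R * measurableTypeR R))
   (fun p : R * R => sqnorm (\sum_i c i * cis ((A i)%:R * p.2 - p.1 * (Q i)%:R))).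
  apply: (measurable_sqnorm_sum R _ _ _ _ (fun (i : I) (p : R * R) => (A i)%:R * p.2 - p.1 * (Q i)%:R)) => i.
  by apply: measurable_funB; apply: measurable_funM.
have pI1 : injective (fun a : 'I_B => a%:Z) by move=> a b [] /val_inj.
have pI2 : injective (fun m : 'I_L => - m%:Z) by move=> a b /oppr_inj [] /val_inj.
have mT : measurable (`[0, T] : set (measurableTypeR R)) by exact: measurable_itv.
have mD := measurable_circle R.
rewrite tonelli_rectangle //; last by move=> p; exact: sqnorm_ge0.
have inner t : (\int[mu]_(x in D)
    (sqnorm (\sum_i c i * cis ((A i)%:R * x - t * (Q i)%:R)))%:E = (2 * pi * W t)%:E)%E.
  under eq_integral do rewrite wave_sum.
  by rewrite (integral_circle_sqnorm_sum R _ _ _ pI1).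
under eq_integral do rewrite inner.
have T1 : T <= 1.
  by apply: le_trans TH; rewrite ler_peMr // ler1n.
(* With the kernel inserted, the integral over [0, T] is enlarged to a full period, the integrand
   being nonnegative and T <= 1; this makes Parseval in t available. *)
apply: le_trans (_ : (\int[mu]_(t in D) (2 * pi * (k ^+ 2)^-1 * V t)%:E <= _)%E).
  apply: le_trans (_ : (\int[mu]_(t in `[0%R, T]) (2 * pi * (k ^+ 2)^-1 * V t)%:E <= _)%E).
    apply: ge0_le_integral => //.
    - by move=> t _; rewrite lee_fin mulr_ge0 // ltW.
    - by apply/measurable_EFinP; apply: (@measurable_funS _ _ _ _ setT) => //; apply: measurable_funM.
    - by apply/measurable_EFinP; apply: (@measurable_funS _ _ _ _ setT) => //; apply: measurable_funM.
    - by move=> t tT; rewrite lee_fin -[leRHS]mulrA ler_wpM2l ?(ltW pi0) // WV.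
  apply: ge0_subset_integral => //.
  - by apply/measurable_EFinP; apply: (@measurable_funS _ _ _ _ setT) => //; apply: measurable_funM.
  - by move=> t _; rewrite lee_fin mulr_ge0 // mulr_ge0 ?invr_ge0 ?exprn_ge0 ?ltW.
  - move=> t /=; rewrite in_itv /= => /andP[t0 tT]; rewrite /circle /= in_itv /= t0 /=.
    by have := @pi_ge2 R; lra.
have -> : (\int[mu]_(t in D) (2 * pi * (k ^+ 2)^-1 * V t)%:E)%E =
    (2 * pi * (k ^+ 2)^-1 * (2 * pi * \sum_a \sum_m sqnorm (e a m)))%:E.
  under eq_integral do rewrite EFinM.
  rewrite ge0_integralZl //=; last 3 first.
  - by apply/measurable_EFinP; apply: (@measurable_funS _ _ _ _ setT).
  - by move=> t _; rewrite lee_fin.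
  - by rewrite lee_fin mulr_ge0 ?invr_ge0 ?exprn_ge0 ?ltW.
  rewrite [RHS]EFinM; congr (_ * _)%E; rewrite /V.
  under eq_integral do rewrite -sumEFin.
  rewrite ge0_integral_sum //; last 2 first.
  - move=> a; apply/measurable_EFinP; apply: (@measurable_funS _ _ _ _ setT) => //.
    apply: (measurable_sqnorm_sum R _ _ _ _ (fun (m : 'I_L) (t : R) => t * (- (nat_of_ord m)%:Z)%:~R)) => m.
    exact: measurable_funM.
  - by move=> a t _; rewrite lee_fin sqnorm_ge0.
  have outer a : (\int[mu]_(t in D) (sqnorm (\sum_m e a m * cis (t * (- m%:Z)%:~R)))%:E =
      (2 * pi * \sum_m sqnorm (e a m))%:E)%E.
    exact: (integral_circle_sqnorm_sum R _ (e a) _ pI2).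
  transitivity (\sum_a (2 * pi * \sum_m sqnorm (e a m))%:E)%E.
    by apply: eq_bigr => a _; exact: outer.
  by rewrite sumEFin mulr_sumr.
rewrite lee_fin.
rewrite [leRHS](_ : _ = 2 * pi * (k ^+ 2)^-1 * (2 * pi * ((M * H)%N%:R * \sum_i sqnorm (c i)))).
  apply: ler_wpM2l; first by rewrite mulr_ge0 ?invr_ge0 ?exprn_ge0 ?(ltW pi0) ?(ltW k0).
  by apply: ler_wpM2l; [exact: ltW | exact: coeff_sum].
by rewrite /k natrM; field; rewrite !gt_eqF.
Qed.

End LocalStrichartz.

(** * From Schrodinger waves to frequency triples *)

Lemma fourier_supp_nat (R : realType) (f : R -> R[i]) (N k : nat) :
  fourier_supp f (N%:R / 2) N%:R -> fourier f k%:Z != 0 -> dyadic_block N k.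
Proof.
move=> fs /fs /andP[h1 h2]; rewrite /dyadic_block -!(ler_nat R) natrM.
move: h1 h2; rewrite -!pmulrn ler_pdivrMr // => h1 ->; rewrite andbT; lra.
Qed.

Lemma schrodinger_sum (R : realType) (f : R -> R[i]) (N : nat) (t x : R) :
  (0 < N)%N -> fourier_supp f (N%:R / 2) N%:R ->
  schrodinger f t x = ((2 * pi)^-1)%:C%C *
    \sum_(k < N.+1) fourier f k%:Z * cis (k%:R * x - t * (k ^ 2)%N%:R).
Proof.
move=> N0 fs; rewrite /schrodinger; congr (_ * _).
apply: (lim_near_cst (@norm_hausdorff _ (GRing.regular R[i]))) => //.
exists N => // n /= Nn.
have neg (k : int) : k < 0 -> fourier f k = 0.
  move=> k0; apply: contraTeq k0 => /fs /andP[h _]; rewrite -leNgt -(ler0z R).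
  by apply: le_trans h; rewrite divr_ge0 ?ler0n.
have big (k : nat) : (N < k)%N -> fourier f k%:Z = 0.
  move=> Nk; apply: contraTeq Nk => /(fourier_supp_nat R f N k fs)/andP[_].
  by rewrite -leqNgt.
rewrite (@big_cat_nat _ _ _ n) //=; last by lia.
rewrite big_nat_cond big1 ?add0r; last first.
  by move=> j /andP[/andP[_ jn] _]; rewrite neg ?mulr0 // subr_lt0 ltz_nat.
rewrite -{1}(add0n n) big_addn (_ : n.*2.+1 - n = n.+1)%N; last by rewrite -addnn; lia.
rewrite (@big_cat_nat _ _ _ N.+1) //= [X in _ + X]big_nat_cond [X in _ + X]big1 ?addr0.
  rewrite big_mkord; apply: eq_bigr => k _.
  rewrite (_ : (k + n)%N%:Z - n%:Z = k%:Z); last by rewrite PoszD addrK.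
  by rewrite mulrC -!pmulrn natrX.
move=> j /andP[/andP[Nj _] _].
by rewrite (_ : (j + n)%N%:Z - n%:Z = j%:Z) ?PoszD ?addrK // big // mulr0.
Qed.

Theorem theorem1p3 (R : realType) (alpha : R) (alpha_gt0 : 0 < alpha) :
  exists C : R, 0 < C /\
    forall (N1 N2 N3 : nat) (f1 f2 f3 : R -> R[i]),
      dyadic N1 -> dyadic N2 -> dyadic N3 ->
      N3%:R <= N1%:R * expR (- ln N1%:R / ln (ln N1%:R)) :> R ->
      L2_circle f1 -> L2_circle f2 -> L2_circle f3 ->
      fourier_supp f1 (N1%:R / 2) N1%:R ->
      fourier_supp f2 (N2%:R / 2) N2%:R ->
      fourier_supp f3 (N3%:R / 2) N3%:R ->
      (\int[(@lebesgue_measure R) \x (@lebesgue_measure R)]_(p in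
            `[0%R, (N1%:R `^ (- alpha))%R] `*` circle R)
          (ComplexField.Normc.normc (schrodinger f1 p.1 p.2) ^+ 2 *
           ComplexField.Normc.normc (schrodinger f2 p.1 p.2) ^+ 2 *
           ComplexField.Normc.normc (schrodinger f3 p.1 p.2) ^+ 2)%:E
       <= C%:E * (L2norm f1 ^+ 2 * L2norm f2 ^+ 2 * L2norm f3 ^+ 2))%E.
Proof.
have [C CP] := triple_count R alpha alpha_gt0.
pose q : R := (2 * pi)^-1.
(* The factors come from [local_strichartz], the count, the squared normalisations of the three
   propagators, and Bessel's inequality for each function. [K + 1] is positive even if C = 0. *)
pose K : R := (2 * pi / cos 1) ^+ 2 * C%:R * (q ^+ 2) ^+ 3 * (2 * pi) ^+ 3.
have pi0 := pi2_gt0 R; have c1 := @cos1_gt0 R.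
have q0 : 0 < q by rewrite invr_gt0.
have K0 : 0 <= K.
  apply: mulr_ge0; last by apply: exprn_ge0; exact: ltW.
  apply: mulr_ge0; last by apply: exprn_ge0; exact: sqr_ge0.
  by apply: mulr_ge0; [exact: sqr_ge0 | exact: ler0n].
exists (K + 1); split; first by rewrite ltr_wpDl.
move=> _ _ _ f1 f2 f3 [nu ->] [n2 ->] [mu ->] cond L1 L2 L3 S1 S2 S3.
set N1 := (2 ^ nu)%N in cond S1 *; set N2 := (2 ^ n2)%N in S2 *; set N3 := (2 ^ mu)%N in cond S3 *.
have N1_gt0 : (0 < N1)%N by rewrite expn_gt0.
have N2_gt0 : (0 < N2)%N by rewrite expn_gt0.
have N3_gt0 : (0 < N3)%N by rewrite expn_gt0.
(* Rounding down gives N1^(-alpha) H <= 1, as the kernel requires, and H >= 1 since N1 >= 1. *)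
pose H := Num.truncn (N1%:R `^ alpha : R).
have Na1 : 1 <= N1%:R `^ alpha :> R.
  apply: le_trans (_ : 1 `^ alpha <= _); first by rewrite powR1.
  apply: (ge0_ler_powR (ltW alpha_gt0)); rewrite ?nnegrE ?ler0n //.
  by rewrite ler1n.
have H0 : (0 < H)%N by rewrite truncn_gt0.
have Hle : H%:R <= N1%:R `^ alpha :> R by rewrite truncn_le // (le_trans ler01).
have Hlt : N1%:R `^ alpha < H.+1%:R :> R by exact: truncnS_gt.
have T0 : 0 <= N1%:R `^ (- alpha) :> R by exact: powR_ge0.
have TH : N1%:R `^ (- alpha) * H%:R <= 1 :> R.
  by rewrite powRN mulrC ler_pdivrMr ?mul1r // (lt_le_trans ltr01).
pose I := ('I_N1.+1 * 'I_N2.+1 * 'I_N3.+1)%type.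
pose tr (k : I) : nat * nat * nat := (nat_of_ord k.1.1, nat_of_ord k.1.2, nat_of_ord k.2).
pose a (k : I) : R[i] := fourier f1 (k.1.1 : nat)%:Z * fourier f2 (k.1.2 : nat)%:Z * fourier f3 (k.2 : nat)%:Z.
pose c (k : I) : R[i] := (q ^+ 3)%:C%C * a k.
have cnt s m : (#|[pred k | [&& c k != 0%R, triple_sum (tr k) == s &
    (m <= triple_sqr (tr k) < m + H)%N]]| <= C * H)%N.
  rewrite cardE -(size_map tr); apply: (CP nu mu N2 s m H) => //.
    rewrite map_inj_uniq ?enum_uniq // => -[[x y] z] [[x' y'] z'] [e1 e2 e3].
    by congr (_, _, _); apply: val_inj.
  move=> _ /mapP[k + ->]; rewrite mem_enum !inE => /and3P[ck sk Qk].
  move: ck; rewrite /c /a !mulf_eq0 !negb_or => /andP[_ /andP[/andP[c1k c2k] c3k]].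
  by apply/and5P; split => //; [exact: fourier_supp_nat S1 _ | exact: fourier_supp_nat S2 _ | exact: fourier_supp_nat S3 _].
have prodE p : ComplexField.Normc.normc (schrodinger f1 p.1 p.2) ^+ 2 *
    ComplexField.Normc.normc (schrodinger f2 p.1 p.2) ^+ 2 *
    ComplexField.Normc.normc (schrodinger f3 p.1 p.2) ^+ 2 =
    sqnorm (\sum_k c k * cis ((triple_sum (tr k))%:R * p.2 - p.1 * (triple_sqr (tr k))%:R)).
  transitivity (sqnorm (schrodinger f1 p.1 p.2) * sqnorm (schrodinger f2 p.1 p.2) *
      sqnorm (schrodinger f3 p.1 p.2)).
    by congr (_ * _ * _); exact: normc_sqr.
  rewrite (schrodinger_sum R f1 N1 p.1 p.2 N1_gt0 S1) (schrodinger_sum R f2 N2 p.1 p.2 N2_gt0 S2).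
  rewrite (schrodinger_sum R f3 N3 p.1 p.2 N3_gt0 S3) -(sqnormM R) -(sqnormM R).
  congr sqnorm; rewrite -/q.
  set U1 := \sum_(k < N1.+1) _; set U2 := \sum_(k < N2.+1) _; set U3 := \sum_(k < N3.+1) _.
  transitivity ((q ^+ 3)%:C%C * (U1 * U2 * U3)).
    by rewrite !rmorphXn /=; ring.
  rewrite /U1 /U2 /U3 big_distrlr /= pair_big /= big_distrlr /= pair_big /= mulr_sumr.
  apply: eq_bigr => -[[x y] z] _ /=; rewrite /c /a /tr /triple_sum /triple_sqr /=.
  rewrite -[RHS]mulrA; congr (_ * _).
  rewrite [LHS](_ : _ = fourier f1 x%:Z * fourier f2 y%:Z * fourier f3 z%:Z *
     (cis (x%:R * p.2 - p.1 * (x ^ 2)%N%:R) * cis (y%:R * p.2 - p.1 * (y ^ 2)%N%:R) *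
      cis (z%:R * p.2 - p.1 * (z ^ 2)%N%:R))); last by ring.
  by rewrite -!cisD; congr (_ * cis _); rewrite !natrD; ring.
under eq_integral do rewrite prodE.
apply: le_trans (local_strichartz R _ c _ _ H (C * H)%N H0 cnt _ T0 TH) _.
rewrite !L2norm_sqr // -!EFinM lee_fin.
have B1 := bessel R f1 L1 N1.+1; have B2 := bessel R f2 L2 N2.+1; have B3 := bessel R f3 L3 N3.+1.
have E0 f : 0 <= \int[@lebesgue_measure R]_(x in circle R) sqnorm (f x).
  by apply: Rintegral_ge0 => x _; exact: sqnorm_ge0.
move: (E0 f1) (E0 f2) (E0 f3) B1 B2 B3.
set E1 := Rintegral _ _ _; set E2 := Rintegral _ _ _; set E3 := Rintegral _ _ _.
set V1 := \sum_(k < N1.+1) _; set V2 := \sum_(k < N2.+1) _; set V3 := \sum_(k < N3.+1) _.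
move=> E1_ge0 E2_ge0 E3_ge0 B1 B2 B3.
have V1_ge0 : 0 <= V1 by apply: sumr_ge0 => k _; exact: sqnorm_ge0.
have V2_ge0 : 0 <= V2 by apply: sumr_ge0 => k _; exact: sqnorm_ge0.
have V3_ge0 : 0 <= V3 by apply: sumr_ge0 => k _; exact: sqnorm_ge0.
have -> : \sum_k sqnorm (c k) = (q ^+ 2) ^+ 3 * (V1 * V2 * V3).
  rewrite /V1 /V2 /V3 big_distrlr /= pair_big /= big_distrlr /= pair_big /= mulr_sumr.
  apply: eq_bigr => -[[x y] z] _ /=; rewrite /c /a !sqnormM; congr (_ * _).
  by rewrite /sqnorm /= expr0n addr0 exprAC.
have VE : V1 * V2 * V3 <= (2 * pi * E1) * (2 * pi * E2) * (2 * pi * E3).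
  by rewrite !ler_pM ?mulr_ge0.
(* The count C H meets the factor 1 / H: the window length cancels and only C remains. *)
rewrite natrM mulfK ?pnatr_eq0 -?lt0n //.
apply: le_trans (_ : K * (E1 * E2 * E3) <= _); last first.
  by rewrite ler_wpM2r ?lerDl // !mulr_ge0.
rewrite [leRHS](_ : _ = (2 * pi / cos 1) ^+ 2 * C%:R * ((q ^+ 2) ^+ 3 *
    ((2 * pi * E1) * (2 * pi * E2) * (2 * pi * E3)))); last by rewrite /K; ring.
apply: ler_wpM2l; first by rewrite mulr_ge0 ?sqr_ge0 ?ler0n.
by apply: ler_wpM2l => //; rewrite exprn_ge0 ?sqr_ge0.
Qed.
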